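(* The set $\mathrm{Bir}_2$ of quadratic birational transformations is smooth in the space $\mathrm{Rat}_2\simeq\mathbb{P}^{17}(\mathbb{C})$ of quadratic rational transformations.
   Context: $\mathrm{Rat}_2\simeq\mathbb{P}^{17}(\mathbb{C})$ is the projectivization of the vector space of triples $(f_0,f_1,f_2)$ of homogeneous polynomials of degree $2$ in $\mathbb{C}[x_0,x_1,x_2]$. $\mathrm{Bir}_2\subset\mathrm{Rat}_2$ is the set of those $f=(f_0:f_1:f_2)$ such that the rational map $f^\bullet$ of $\mathbb{P}^2(\mathbb{C})$ obtained by dividing the $f_i$ by their gcd is birational. (In particular $\mathrm{Bir}_2$ contains the elements $\ell(\ell_0:\ell_1:\ell_2)$ with $\ell\ne0$ a linear form and $\ell_0,\ell_1,\ell_2$ linearly independent linear forms.) ''Smooth'' means that $\mathrm{Bir}_2$ is a (locally closed) complex submanifold of $\mathbb{P}^{17}(\mathbb{C})$ near each of its points. *)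

(* Defs.v *)
From HB Require Import structures.
From mathcomp Require Import all_boot all_order all_algebra.
(* Its notations clash with those of mathcomp-analysis. *)
From mathcomp.multinomials Require Import -(notations) mpoly.
From mathcomp Require Import all_classical all_reals all_analysis.
From mathcomp Require Import complex.

Set Implicit Arguments.
Unset Strict Implicit.
Unset Printing Implicit Defensive.

Import Order.TTheory GRing.Theory Num.Theory.
Import numFieldNormedType.Exports.

Local Open Scope classical_set_scope.
Local Open Scope ring_scope.

Section Submanifold.
Variables (K : numFieldType) (n : nat).

(* Near each of its points, S is the zero set of a differentiable map
   F : U -> K^k whose Jacobian matrix has rank k throughout the open set U.
   The differential is K-linear, so for K = R[i] differentiability on U means
   that F is holomorphic, and S is a (locally closed) complex submanifold.
   The codimension k may depend on the point. *)
Definition submanifold (S : set 'rV[K]_n) : Prop :=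
  forall x, S x ->
    exists (U : set 'rV[K]_n) (k : nat) (F : 'rV[K]_n -> 'rV[K]_k),
      [/\ open U, U x,
          forall z, U z -> differentiable F z,
          forall z, U z -> \rank ('J F z) = k
        & forall z, U z -> (S z <-> F z = 0)].

End Submanifold.

Section Projective.
Variables (K : numFieldType) (n : nat).

Definition projspace : Type := {L : {vspace 'rV[K]_n.+1} | \dim L == 1%N}.

(* y with the coordinate 1 inserted at position i *)
Definition affine_vec (i : 'I_n.+1) (y : 'rV[K]_n) : 'rV[K]_n.+1 :=
  \row_j oapp (fun k => y 0 k) 1 (unlift i j).

Lemma affine_vec_line i y : \dim <[affine_vec i y]>%VS == 1%N.
Proof.
rewrite dim_vline; suff -> : affine_vec i y != 0 by [].
apply/eqP => /rowP /(_ i); rewrite !mxE unlift_none /=.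
by apply/eqP; exact: oner_neq0.
Qed.

(* The inverse of the standard chart {x_i != 0} -> K^n. *)
Definition affine_pt (i : 'I_n.+1) (y : 'rV[K]_n) : projspace :=
  exist _ <[affine_vec i y]>%VS (affine_vec_line i y).

(* The manifold structure of P^n is given by the n+1 standard charts, whose
   domains are open and cover P^n: S is a submanifold of P^n if and only if its
   trace on each of them is a submanifold of K^n. *)
Definition proj_submanifold (S : set projspace) : Prop :=
  forall i, submanifold (affine_pt i @^-1` S).

End Projective.

Section Rational.
Variable K : numFieldType.

Local Notation poly3 := (mpoly.mpoly 3 K).
Local Notation homog d := (mpoly.ishomog1 d mpoly.mdeg).
Local Notation X i := (mpoly.mpolyX K (mpoly.mnm1 i)).

Definition mdvd (p q : poly3) : Prop := exists r, q = p * r.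

Definition is_gcd (d : poly3) (f : 3.-tuple poly3) : Prop :=
  (forall i, mdvd d (tnth f i)) /\
  (forall e, (forall i, mdvd e (tnth f i)) -> mdvd e d).

Definition tuple_neq0 (f : 3.-tuple poly3) : Prop :=
  exists i, tnth f i != 0.

(* f represents a rational map P^2 --> P^2 *)
Definition is_ratmap (f : 3.-tuple poly3) : Prop :=
  (exists d : nat, forall i, tnth f i \is homog d) /\ tuple_neq0 f.

(* f and g, both nonzero, represent the same rational map *)
Definition ratmap_eq (f g : 3.-tuple poly3) : Prop :=
  forall i j, tnth f i * tnth g j = tnth f j * tnth g i.

Definition ratmap_comp (g f : 3.-tuple poly3) : 3.-tuple poly3 :=
  [tuple mpoly.comp_mpoly f (tnth g i) | i < 3].

Definition ratmap_id : 3.-tuple poly3 := [tuple X i | i < 3].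

(* ratmap_comp g f is zero when the image of f lies in the indeterminacy
   locus of g, in which case g \o f is not defined as a rational map. *)
Definition birational (f : 3.-tuple poly3) : Prop :=
  is_ratmap f /\
  exists g, [/\ is_ratmap g,
    tuple_neq0 (ratmap_comp g f), ratmap_eq (ratmap_comp g f) ratmap_id,
    tuple_neq0 (ratmap_comp f g) & ratmap_eq (ratmap_comp f g) ratmap_id].

Definition quad_monomials : 6.-tuple poly3 :=
  let x := X (inord 0) in let y := X (inord 1) in let z := X (inord 2) in
  [tuple x * x; x * y; x * z; y * y; y * z; z * z].

Definition Rat2 : Type := projspace K 17.

(* The linear isomorphism between K^18 = K^(3 * 6) and the space of triples of
   ternary quadratic forms. *)
Definition quad_triple (v : 'rV[K]_18) : 3.-tuple poly3 :=
  [tuple \sum_(j < 6) (vec_mx (v : 'rV[K]_(3 * 6)) i j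
                         *: tnth quad_monomials j) | i < 3].

(* g is f divided by a gcd of its components *)
Definition is_reduced_map (f g : 3.-tuple poly3) : Prop :=
  exists d, is_gcd d f /\ forall i, tnth f i = d * tnth g i.

Definition Bir2 : set Rat2 :=
  [set p | exists v : 'rV[K]_18, val p = <[v]>%VS /\
     exists g, is_reduced_map (quad_triple v) g /\ birational g].

End Rational.

(* Main.v *)
Require Import Defs.
From mathcomp Require Import all_boot all_order all_algebra.
From mathcomp.multinomials Require Import -(notations) mpoly.
From mathcomp Require Import all_classical all_reals all_analysis.
From mathcomp Require Import complex ring.

(* Let f be a quadratic triple, f(e, .) its polar form at a point e, and
   suppose f(e, .) invertible. After a linear change of the target, in
   coordinates (x, w) with e = (1, 0), w = (y, z), one has
     f = (x^2 + p1(w), x w + p(w)),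
   and p(w) = N(w) w for a unique traceless 2x2 matrix N of linear forms.
   Then f is in Bir_2 if and only if p1 = det N. These three equations are
   the graph of a function of p, so they define a submanifold, and every f in
   Bir_2 admits such an e.

   - If p1 = det N then f = (det(x + N), (x + N) w), so y = f(x, w) satisfies
     y1 w = (x - N(w)) (y2, y3): given y, this is a linear system in (x, w),
     whose solution is a quadratic inverse of f. When the cubic w /\ p(w) is
     nonzero, f is reduced; otherwise f is a linear form times a linear map.
   - If g(f(x)) is a nonzero multiple of x at x = e, then f(e, .) is
     invertible: if f(e, u) = 0, then f(e + t u), hence g(f(e + t u)), is
     constant to first order in t, and so u is a multiple of e.
   - Conversely, let f in Bir_2, and fix a direction w0. For each direction w,
     the equation f(s', w) = lambda f(s, w0) amounts to a cubic equation in s,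
     whose leading coefficient is the cubic c(w) = w /\ p(w). Generic
     injectivity forces its roots s to lie in a finite set independent of w,
     so the ratio of its two leading coefficients does not depend on w. Hence
     the cubic c divides the quadratic form p1 - det N, which therefore
     vanishes. If c = 0, the same argument applies on a single line w = w0. *)

Set Implicit Arguments.
Unset Strict Implicit.
Unset Printing Implicit Defensive.

Import Order.TTheory GRing.Theory Num.Theory.
Import numFieldNormedType.Exports.

Local Open Scope classical_set_scope.
Local Open Scope ring_scope.

(** * Transversality and the traceless determinant *)

Lemma poly_fun_eq0 (K : numDomainType) (p : {poly K}) :
  (forall t, p.[t] = 0) -> p = 0.
Proof.
move=> p0; apply/eqP; apply: contraT => nzp.
(* In characteristic zero the naturals below [size p] are distinct, so they would be one root too
   many. *)
suff : (size [seq i%:R : K | i <- iota 0 (size p)] < size p)%N.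
  by rewrite size_map size_iota ltnn.
apply: max_poly_roots => //; first by apply/allP => x _; apply/rootP.
by rewrite map_inj_uniq ?iota_uniq// => i j /eqP; rewrite eqr_nat => /eqP.
Qed.

(** Degree 4 covers every coefficient comparison made below; shorter identities are padded with
    zeros. *)
Lemma quartic_fun_eq0 (K : numDomainType) (k0 k1 k2 k3 k4 : K) :
  (forall t, k0 + k1 * t + k2 * t ^+ 2 + k3 * t ^+ 3 + k4 * t ^+ 4 = 0) ->
  [/\ k0 = 0, k1 = 0, k2 = 0, k3 = 0 & k4 = 0].
Proof.
move=> k_eq0; pose p : {poly K} := Poly [:: k0; k1; k2; k3; k4].
have p0 : p = 0.
  apply: poly_fun_eq0 => t; rewrite horner_Poly/= -[RHS](k_eq0 t); ring.
by split; [have := congr1 (coefp 0) p0 | have := congr1 (coefp 1) p0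
  | have := congr1 (coefp 2) p0 | have := congr1 (coefp 3) p0
  | have := congr1 (coefp 4) p0]; rewrite /= coef_Poly coef0.
Qed.

Lemma monic_cubic_roots (K : closedFieldType) (c0 c1 c2 : K) :
  exists s1 s2 s3, forall x,
    x ^+ 3 + c2 * x ^+ 2 + c1 * x + c0 = (x - s1) * (x - s2) * (x - s3).
Proof.
pose p : {poly K} := Poly [:: c0; c1; c2; 1].
have pE : p = [:: c0; c1; c2; 1] :> seq K by rewrite (PolyK (c := 0)) ?oner_neq0.
have [r pr] := closed_field_poly_normal p.
have lp : lead_coef p = 1 by rewrite /lead_coef pE.
have := size_prod_XsubC r id; rewrite -[X in polyseq X]scale1r -lp -pr pE.
case: r pr => [|s1 [|s2 [|s3 [|]]]]//= pr _; exists s1, s2, s3 => x.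
have := congr1 (horner^~ x) pr.
rewrite lp scale1r !big_cons big_nil mulr1 !hornerM !hornerXsubC mulrA => <-.
by rewrite horner_Poly/=; ring.
Qed.

Definition binquad (K : comNzRingType) (a b c y z : K) :=
  a * y ^+ 2 + b * y * z + c * z ^+ 2.

Section NormalForm.
Variables (K : numClosedFieldType) (P Q R a b c d e f : K).

(* For the traceless N with N(w) w = (a y^2 + b y z + c z^2, d y^2 + e y z + f z^2),
   namely N = [[a y - f z, (b + f) y + c z], [d y + (e + a) z, f z - a y]], these
   are the coefficients of (P y^2 + Q y z + R z^2) - det N. *)
Definition traceless_det : Prop :=
  [/\ P + a ^+ 2 + d * (b + f) = 0,
      Q - 2 * a * f + (b + f) * (e + a) + c * d = 0
    & R + f ^+ 2 + c * (e + a) = 0].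

Definition nf1 (x y z : K) := x ^+ 2 + binquad P Q R y z.
Definition nf2 (x y z : K) := x * y + binquad a b c y z.
Definition nf3 (x y z : K) := x * z + binquad d e f y z.

(** Write w0 = (1, [tau]). Every direction other than w0 is spanned by a unique w = t w0 + (0, 1).
    For each such w, the roots [s] of the cubic equation are roots of [th], so their sum takes
    finitely many values as t varies; being a ratio of polynomials in t, it is constant. *)
Lemma traceless_det_of_transverse (tau : K) (th : {poly K}) :
  th != 0 -> tau * binquad a b c 1 tau != binquad d e f 1 tau ->
  (forall s x y z lam : K, lam != 0 ->
     nf1 x y z = lam * nf1 s 1 tau -> nf2 x y z = lam * nf2 s 1 tau ->
     nf3 x y z = lam * nf3 s 1 tau -> z = y * tau \/ root th s) ->
  traceless_det.
Proof.
move=> th0 cub0 inj_nf.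
pose hE := (hornerD, hornerN, hornerM, hornerC, hornerX, horner_exp).
(* Coordinates adapted to w0 and w: p(w0) = [aa t] w0 + [B0] w and p(w) = [ast t] w0 + [Bt t] w.
   Thus [ast t] is, up to sign, the cubic w /\ p(w). *)
pose A0 := binquad a b c 1 tau.
pose B0 := binquad d e f 1 tau - tau * A0.
have B0N0 : B0 != 0 by rewrite subr_eq0 eq_sym.
pose B1 := e + 2 * f * tau - tau * (b + 2 * c * tau).
pose B2 := f - tau * c.
pose ast (t : K) : K := - B0 * t ^+ 3 + (A0 - B1) * t ^+ 2 + (b + 2 * c * tau - B2) * t + c.
pose aa t := A0 - t * B0.
pose Bt t := B0 * t ^+ 2 + B1 * t + B2.
(* When [ast t] is nonzero, [U t / ast t] is the sum of the three roots [s]. *)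
pose U t := Bt t ^+ 2 + binquad P Q R t (t * tau + 1) - ast t * aa t.
have [r thr] := closed_field_poly_normal th.
have rP s : root th s -> s \in r.
  by rewrite thr rootZ ?lead_coef_eq0// root_prod_XsubC.
pose Z := [seq s12 + s3 | s12 <- [seq s1 + s2 | s1 <- r, s2 <- r], s3 <- r].
have UZ t : ast t != 0 -> exists2 z, z \in Z & U t = z * ast t.
  move=> astN0.
  pose p1t := binquad P Q R t (t * tau + 1).
  pose c2 := - U t / ast t.
  (* Put [sg] = s + [aa t]. Comparing the coefficients of w0 and w in the last two equations gives
     lam = [ast t / sg] and x = lam [B0] - [Bt t]; the first equation then becomes [C sg = 0]. *)
  pose C (sg : K) := sg ^+ 3 - (Bt t ^+ 2 + p1t + 2 * aa t * ast t) / ast t * sg ^+ 2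
     + (2 * B0 * Bt t + aa t ^+ 2 + binquad P Q R 1 tau) * sg - B0 ^+ 2 * ast t.
  have root_C s : C (s + aa t) = 0 -> s \in r.
    set sg := s + aa t => Csg.
    (* The constant term of [C] is nonzero, so lam is well defined. *)
    have sgN0 : sg != 0.
      apply: contra_neq B0N0 => sg0; move: Csg; rewrite sg0.
      have -> : C 0 = - (B0 ^+ 2 * ast t) by rewrite /C; ring.
      move=> /eqP.
      by rewrite oppr_eq0 mulf_eq0 (negPf astN0) orbF expf_eq0/= => /eqP.
    apply: rP.
    have := inj_nf s (ast t / sg * B0 - Bt t) t (t * tau + 1) (ast t / sg).
    have sE : s = sg - aa t by rewrite /sg addrK.
    case=> //.
    - by rewrite mulf_neq0 ?invr_neq0.
    - rewrite /nf1 -/p1t; set p10 := binquad _ _ _ 1 tau.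
      apply/eqP; rewrite -subr_eq0; apply/eqP.
      transitivity (- (ast t / sg) ^+ 2 / ast t * C sg); last by rewrite Csg mulr0.
      rewrite /C -/p10 sE; field; exact/andP.
    - rewrite /nf2 sE -/A0 /aa /ast /Bt /B1 /B2.
      have -> : binquad a b c t (t * tau + 1) =
        A0 * t ^+ 2 + (b + 2 * c * tau) * t + c by rewrite /A0 /binquad; ring.
      by field.
    - rewrite /nf3 sE -/(binquad d e f 1 tau).
      have -> : binquad d e f 1 tau = B0 + tau * A0 by rewrite /B0 subrK.
      have -> : binquad d e f t (t * tau + 1) = Bt t + tau * binquad a b c t (t * tau + 1).
        by rewrite /Bt /B0 /B1 /B2 /A0 /binquad; ring.
      have -> : binquad a b c t (t * tau + 1) = ast t + t * Bt t.
        by rewrite /ast /Bt /B1 /B2 /A0 /binquad; ring.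
      by rewrite /aa; field.
    (* Here z - y [tau] = 1, so the two directions differ. *)
    - by move=> /eqP; rewrite -subr_eq0 addrAC subrr add0r oner_eq0.
  have [c1 [c0 CE]] : exists c1 c0, forall s,
      C (s + aa t) = s ^+ 3 + c2 * s ^+ 2 + c1 * s + c0.
    exists (3 * aa t ^+ 2
      - 2 * aa t * ((Bt t ^+ 2 + p1t + 2 * aa t * ast t) / ast t)
      + (2 * B0 * Bt t + aa t ^+ 2 + binquad P Q R 1 tau)), (C (aa t)) => s.
    by rewrite /C /c2 /U -/p1t; field.
  have [s1 [s2 [s3 sE]]] := monic_cubic_roots c0 c1 c2.
  have Cr s : C (s + aa t) = (s - s1) * (s - s2) * (s - s3) by rewrite CE sE.
  exists (s1 + s2 + s3).
    have [s1r s2r s3r] : [/\ s1 \in r, s2 \in r & s3 \in r].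
      by split; apply/root_C/(etrans (Cr _)); rewrite subrr ?mulr0 ?mul0r.
    by apply: allpairs_f s3r; apply: allpairs_f.
  have [_ _ c2E _ _] : [/\ c0 + s1 * s2 * s3 = 0,
      c1 - (s1 * s2 + s1 * s3 + s2 * s3) = 0, c2 + (s1 + s2 + s3) = 0,
      0 = 0 :> K & 0 = 0 :> K].
    apply: quartic_fun_eq0 => s.
    transitivity (s ^+ 3 + c2 * s ^+ 2 + c1 * s + c0
      - (s - s1) * (s - s2) * (s - s3)); [ring | by rewrite sE subrr].
  have -> : U t = - c2 * ast t by rewrite /c2; field.
  by move/eqP: c2E; rewrite addr_eq0 => /eqP ->; rewrite opprK.
have [z zE] : exists z, forall t, U t = z * ast t.
  pose X := 'X : {poly K}.
  have [astp astpE] : exists p : {poly K}, forall t, p.[t] = ast t.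
    exists ((- B0)%:P * X ^+ 3 + (A0 - B1)%:P * X ^+ 2
      + (b + 2 * c * tau - B2)%:P * X + c%:P) => t.
    by rewrite /X !hE.
  have [Up UpE] : exists p : {poly K}, forall t, p.[t] = U t.
    exists ((B0%:P * X ^+ 2 + B1%:P * X + B2%:P) ^+ 2
      + binquad P%:P Q%:P R%:P X (X * tau%:P + 1)
      - astp * (A0%:P - X * B0%:P)) => t.
    by rewrite /X /binquad !hE astpE.
  have astp0 : astp != 0.
    apply/eqP => astp0; move: B0N0; rewrite -oppr_eq0.
    have [] := @quartic_fun_eq0 K c (b + 2 * c * tau - B2) (A0 - B1) (- B0) 0.
      move=> t; apply: etrans (etrans (esym (astpE t)) _); last by rewrite astp0 horner0.
      by rewrite /ast; ring.
    by move=> _ _ _ ->; rewrite eqxx.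
  (* At each t some factor vanishes, the choice depending on t. As polynomials form a domain, one
     factor is zero identically, and its [z] works for all t. *)
  have : astp * \prod_(z <- Z) (Up - z%:P * astp) = 0.
    apply: poly_fun_eq0 => t; rewrite hornerM astpE.
    have [->|/UZ[z zZ Uz]] := eqVneq (ast t) 0; first by rewrite mul0r.
    rewrite horner_prod (big_rem z)//= !hE UpE astpE Uz subrr.
    by rewrite mul0r mulr0.
  move/eqP; rewrite mulf_eq0 (negPf astp0)/= prodf_seq_eq0 => /hasP[z _ /=].
  rewrite subr_eq0 => /eqP Upz; exists z => t.
  by rewrite -UpE -astpE Upz !hE.
(* [D1], [D2], [D3] are the coefficients of det N - p1, and [z * ast - U] equals (det N - p1)(w) +
   [ast t] ([l1] t + [l0]). Since [ast] has degree exactly 3, with leading coefficient [- B0], the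
   terms of degree 4 and 3 force [l1 = l0 = 0]. *)
pose D1 := - (P + a ^+ 2 + d * (b + f)).
pose D2 := - (Q - 2 * a * f + (b + f) * (e + a) + c * d).
pose D3 := - (R + f ^+ 2 + c * (e + a)).
pose n1 := d + (e + a) * tau - 2 * tau * (a - f * tau) - tau ^+ 2 * (b + f + c * tau).
pose n0 := e + a + 2 * tau * f - tau ^+ 2 * c.
pose l1 := n1 - B0.
pose l0 := z + A0 + n0.
have [D3E D2E D1E k3 k4] : [/\ D3 + c * l0 = 0,
    D2 + 2 * tau * D3 + (c * l1 + (b + 2 * c * tau - B2) * l0) = 0,
    binquad D1 D2 D3 1 tau + ((b + 2 * c * tau - B2) * l1 + (A0 - B1) * l0) = 0,
    - B0 * l0 + (A0 - B1) * l1 = 0 & - B0 * l1 = 0].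
  apply: quartic_fun_eq0 => t.
  transitivity (z * ast t - U t); last by rewrite zE subrr.
  rewrite /U /ast /aa /Bt /l0 /l1 /n0 /n1 /D1 /D2 /D3 /B1 /B2 /B0 /A0 /binquad.
  ring.
have l1E : l1 = 0.
  by move/eqP: k4; rewrite mulf_eq0 oppr_eq0 (negPf B0N0) => /eqP.
have l0E : l0 = 0.
  by move/eqP: k3; rewrite l1E mulr0 addr0 mulf_eq0 oppr_eq0 (negPf B0N0) => /eqP.
have D30 : D3 = 0 by rewrite -[RHS]D3E l0E mulr0 addr0.
have D20 : D2 = 0 by rewrite -[RHS]D2E l0E l1E D30 !mulr0 !addr0.
have D10 : D1 = 0.
  rewrite -[RHS]D1E l0E l1E D30 D20 /binquad expr1n !mul0r !mulr0 !addr0.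
  by rewrite mulr1.
by split; apply/eqP; rewrite -oppr_eq0; apply/eqP.
Qed.
End NormalForm.

(** * Polynomials as functions *)

(** Uniqueness of digits in base [N]: it keeps distinct monomials distinct under the Kronecker
    substitution. *)
Lemma digits_inj (n N : nat) (u v : 'I_n -> nat) :
  (forall i, u i < N)%N -> (forall i, v i < N)%N ->
  (\sum_i u i * N ^ i = \sum_i v i * N ^ i)%N -> u =1 v.
Proof.
elim: n u v => [|n IHn] u v uN vN; first by move=> _ [].
have digits_recl (w : 'I_n.+1 -> nat) : (\sum_i w i * N ^ i =
    w ord0 + N * \sum_(i < n) w (lift ord0 i) * N ^ i)%N.
  rewrite big_ord_recl expn0 muln1 big_distrr/=; congr (_ + _)%N.
  by apply: eq_bigr => i _; rewrite expnS mulnCA.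
rewrite !digits_recl => eq_uv.
have N0 : (0 < N)%N by apply: leq_ltn_trans (uN ord0).
have uv0 : u ord0 = v ord0.
  by move/(congr1 (modn^~ N)): eq_uv; rewrite ![(N * _)%N]mulnC;
    rewrite ![(_ ord0 + _)%N]addnC !modnMDl !modn_small.
move=> i; case: (unliftP ord0 i) => [j|] -> //.
apply: (IHn (u \o lift ord0) (v \o lift ord0)) => [k|k|]; rewrite ?uN ?vN//.
by move/eqP: eq_uv; rewrite uv0 eqn_add2l eqn_pmul2l// => /eqP.
Qed.

Section MpolyFun.
Variables (n : nat).

(** Restriction to a parametrized curve, which reduces later arguments to polynomials in one
    variable. *)
Lemma meval_curve (K : comNzRingType) (p : mpoly n K) (c : 'I_n -> {poly K}) :
  exists s : {poly K}, forall t, s.[t] = meval (fun i => (c i).[t]) p.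
Proof.
exists (mmap polyC c p) => t; rewrite mevalE horner_sum.
apply: eq_bigr => m _; rewrite hornerM hornerC horner_prod.
by congr (_ * _); apply: eq_bigr => i _; rewrite horner_exp.
Qed.

Variable K : numDomainType.
Implicit Types p q : mpoly n K.

(* Kronecker substitution x_i := t ^ (N ^ i), with N larger than the degrees. *)
Lemma mpoly_fun_eq0 p : (forall v, meval v p = 0) -> p = 0.
Proof.
move=> p0; pose N := msize p.
pose kr (m : multinom n) := (\sum_i m i * N ^ i)%N.
pose s : {poly K} := \sum_(m <- msupp p) mcoeff m p *: 'X^(kr m).
have s0 : s = 0.
  apply: poly_fun_eq0 => t; rewrite -(p0 (fun i => t ^+ (N ^ i))) mevalE.
  rewrite horner_sum; apply: eq_bigr => m _; rewrite hornerZ hornerXn.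
  congr (_ * _); rewrite /kr expr_sum; apply: eq_bigr => i _.
  by rewrite -exprM mulnC.
have supp_lt m i : m \in msupp p -> (m i < N)%N.
  move/msize_mdeg_lt; apply: leq_ltn_trans.
  by rewrite mdegE (bigD1 i)//= leq_addr.
apply/mpolyP => m; rewrite mcoeff0.
have [mp|] := boolP (m \in msupp p); last by move/memN_msupp_eq0.
have := congr1 (coefp (kr m)) s0; rewrite /= coef0 coef_sum => <-.
rewrite (big_rem m)//= coefZ coefXn eqxx mulr1 big_seq big1 ?addr0// => m'.
rewrite mem_rem_uniq ?msupp_uniq// inE => /andP[m'm m'p].
rewrite coefZ coefXn; case: eqP; rewrite ?mulr0// => /esym kr_eq.
case/eqP: m'm; apply/mnmP; apply: digits_inj kr_eq => i; exact: supp_lt.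
Qed.

Lemma mpoly_fun_inj p q : (forall v, meval v p = meval v q) -> p = q.
Proof.
move=> pq; apply/eqP; rewrite -subr_eq0; apply/eqP; apply: mpoly_fun_eq0 => v.
by rewrite mevalB pq subrr.
Qed.

Lemma meval_homog d p (l : K) (v : 'I_n -> K) :
  p \is ishomog1 d mdeg -> meval (fun i => l * v i) p = l ^+ d * meval v p.
Proof.
move/dhomogP => hp; rewrite !mevalE mulr_sumr big_seq [RHS]big_seq.
apply: eq_bigr => m /hp m_d; have {m_d}<- : mdeg m = d := m_d.
rewrite mulrCA mdegE; congr (_ * _); rewrite expr_sum -big_split/=; apply: eq_bigr => i _.
by rewrite exprMn.
Qed.

End MpolyFun.

Lemma mpoly_neq0_point (n : nat) (K : numDomainType) (p : mpoly n K) :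
  p != 0 -> exists v, meval v p != 0.
Proof.
move=> /eqP p0; apply: contrapT => all0; apply: p0; apply: mpoly_fun_eq0 => v.
by apply: contrapT => /eqP pv; apply: all0; exists v.
Qed.

Definition tri (K : Type) (x y z : K) : 'I_3 -> K :=
  fun i => nth x [:: x; y; z] i.

Lemma triE (K : Type) (v : 'I_3 -> K) :
  v = tri (v (inord 0)) (v (inord 1)) (v (inord 2)).
Proof.
apply/funext => i; rewrite /tri.
have -> : i = inord i by rewrite inord_val.
by case: i => [[|[|[|]]]]//= ?; rewrite inordK.
Qed.

Section TracelessDet.
Variables (K : numClosedFieldType) (P Q R a b c d e f : K).

Local Notation X i := (mpolyX K (mnm1 (inord i : 'I_3))).

Lemma meval_X i x y z : (i < 3)%N ->
  meval (tri x y z) (X i) = nth x [:: x; y; z] i :> K.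
Proof. by move=> i3; rewrite mevalXU /tri inordK. Qed.

(** If the cubic w /\ p(w) is not zero, a point off [th] and off the cubic provides a direction w0
    for the transverse argument. Otherwise p(w) is a linear form times w, and injectivity already
    fails inside a single line w = w0 unless p1 = det N. *)
Lemma traceless_det_of_inj (th : mpoly 3 K) :
  th != 0 ->
  (forall x y z x' y' z' lam : K, lam != 0 ->
     nf1 P Q R x' y' z' = lam * nf1 P Q R x y z ->
     nf2 a b c x' y' z' = lam * nf2 a b c x y z ->
     nf3 d e f x' y' z' = lam * nf3 d e f x y z ->
     (y' * z = z' * y /\ x' * y = y' * x) \/ meval (tri x y z) th = 0) ->
  traceless_det P Q R a b c d e f.
Proof.
move=> th0 inj_nf.
have evE := (mevalM, mevalD, mevalN, meval_X, mevalC).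
pose cub (y z : K) := z * binquad a b c y z - y * binquad d e f y z.
have [[t0 cub0]|cub_eq0] := pselect (exists t, cub 1 t != 0).
  pose C : mpoly 3 K :=
    X 2 * binquad (mpolyC 3 a) (mpolyC 3 b) (mpolyC 3 c) (X 1) (X 2)
    - X 1 * binquad (mpolyC 3 d) (mpolyC 3 e) (mpolyC 3 f) (X 1) (X 2).
  have CE x y z : meval (tri x y z) C = cub y z.
    by rewrite /C /binquad /cub !expr2 !evE.
  have C0 : C != 0.
    by apply: contra_neq cub0 => C0; rewrite -(CE 0) C0 meval0.
  have X0 : X 1 != 0.
    apply: contra_neq (oner_neq0 K) => X0.
    by rewrite -[LHS](meval_X (i := 1) 0 1 0)// X0 meval0.
  have [v] := mpoly_neq0_point (mulf_neq0 th0 (mulf_neq0 X0 C0)).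
  rewrite (triE v) 2!mevalM CE meval_X//=.
  move: (v (inord 0)) (v (inord 1)) (v (inord 2)) => x0 y0 z0.
  rewrite !mulf_eq0 !negb_or => /and3P[thv y0N0 cubv].
  (* The curve is t -> [y0] (t, 1, [z0 / y0]). Since the normal form is quadratic, rescaling by [y0]
     divides [lam] by [y0 ^+ 2] below. *)
  have [s sE] := meval_curve th (tri ('X * y0%:P) y0%:P z0%:P).
  have {}sE t : s.[t] = meval (tri (t * y0) y0 z0) th.
    rewrite sE; apply: meval_eq => -[[|[|[|]]]]//= ?;
    by rewrite /tri/= ?hornerM ?hornerX ?hornerC.
  apply: (@traceless_det_of_transverse _ P Q R a b c d e f (z0 / y0) s).
  - apply: contra_neq thv => s0.
    by rewrite -[x0](mulfVK y0N0) -sE s0 horner0.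
  - apply: contra_neq cubv => eq_cub.
    transitivity (y0 ^+ 3 * ((z0 / y0) * binquad a b c 1 (z0 / y0)
      - binquad d e f 1 (z0 / y0))); last by rewrite eq_cub subrr mulr0.
    by rewrite /cub /binquad; field.
  - move=> t x y z lam lam0 E1 E2 E3.
    have [||||[yz _]|thE] := inj_nf (t * y0) y0 z0 x y z (lam / y0 ^+ 2).
    + by rewrite mulf_neq0// invr_eq0 expf_eq0.
    + by rewrite E1 /nf1 /binquad; field.
    + by rewrite E2 /nf2 /binquad; field.
    + by rewrite E3 /nf3 /binquad; field.
    + by left; rewrite mulrA yz mulfK.
    + by right; rewrite /root sE thE.
have {}cub_eq0 t : cub 1 t = 0.
  by apply: contrapT => /eqP cubt; apply: cub_eq0; exists t.
have [d0 ae bf c0 _] : [/\ - d = 0, a - e = 0, b - f = 0, c = 0 & 0 = 0 :> K].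
  apply: quartic_fun_eq0 => t; rewrite -[RHS](cub_eq0 t) /cub /binquad; ring.
have {}d0 : d = 0 by apply/eqP; rewrite -oppr_eq0 d0.
have {}ae : e = a by apply/esym/eqP; rewrite -subr_eq0 ae.
have {}bf : f = b by apply/esym/eqP; rewrite -subr_eq0 bf.
subst d e f c.
(* Now p(w) = (a y + b z) w and det N = - (a y + b z)^2, so [D] is p1 - det N. *)
pose D (y z : K) := (a * y + b * z) ^+ 2 + binquad P Q R y z.
have [[t0 D0]|D_eq0] := pselect (exists t, D 1 t != 0); last first.
  have {}D_eq0 t : D 1 t = 0.
    by apply: contrapT => /eqP Dt; apply: D_eq0; exists t.
  have [D1 D2 D3 _ _] : [/\ P + a ^+ 2 = 0, Q + 2 * a * b = 0, R + b ^+ 2 = 0,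
      0 = 0 :> K & 0 = 0 :> K].
    apply: quartic_fun_eq0 => t; rewrite -[RHS](D_eq0 t) /D /binquad; ring.
  split; first by rewrite mul0r addr0.
    by rewrite -[RHS]D2; ring.
  by rewrite mul0r addr0.
pose Dp : mpoly 3 K := (mpolyC 3 a * X 1 + mpolyC 3 b * X 2) ^+ 2
  + binquad (mpolyC 3 P) (mpolyC 3 Q) (mpolyC 3 R) (X 1) (X 2).
have DpE x y z : meval (tri x y z) Dp = D y z.
  by rewrite /Dp /binquad /D !expr2 !evE.
have Dp0 : Dp != 0.
  by apply: contra_neq D0 => Dp0; rewrite -(DpE 0) Dp0 meval0.
have X0 : X 1 != 0.
  apply: contra_neq (oner_neq0 K) => X0.
  by rewrite -[LHS](meval_X (i := 1) 0 1 0)// X0 meval0.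
have [v] := mpoly_neq0_point (mulf_neq0 th0 (mulf_neq0 X0 Dp0)).
rewrite (triE v) 2!mevalM DpE meval_X//=.
move: (v (inord 0)) (v (inord 1)) (v (inord 2)) => x0 y0 z0.
rewrite !mulf_eq0 !negb_or => /and3P[thv y0N0 Dv].
have [s sE] := meval_curve th (tri 'X y0%:P z0%:P).
have {}sE t : s.[t] = meval (tri t y0 z0) th.
  rewrite sE; apply: meval_eq => -[[|[|[|]]]]//= ?;
  by rewrite /tri/= ?hornerX ?hornerC.
pose m := a * y0 + b * z0.
(* With sg = x + [m], the image of (x, w0) is (sg + D / sg - 2 m : w0), which the involution sg -> D
   / sg preserves. Hence every x is a root of [s], or has sg = 0, or is a fixed point sg^2 = D; the
   product gathers these three cases. *)
exfalso; suff : s * (('X + m%:P) * (('X + m%:P) ^+ 2 - (D y0 z0)%:P)) = 0.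
  apply/eqP; rewrite !mulf_neq0//.
  - by apply: contra_neq thv => s0; rewrite -sE s0 horner0.
  - by rewrite -size_poly_eq0 size_XaddC.
  - apply/eqP => /(congr1 (horner^~ (- m))).
    rewrite !(hornerD, hornerN, horner_exp, hornerX, hornerC, horner0) addNr.
    by rewrite expr0n/= sub0r => /eqP; rewrite oppr_eq0 (negPf Dv).
apply: poly_fun_eq0 => t.
rewrite !(hornerM, hornerD, hornerN, horner_exp, hornerX, hornerC).
have [->|sg0] := eqVneq (t + m) 0; first by rewrite mul0r mulr0.
have [->|Dsg] := eqVneq ((t + m) ^+ 2 - D y0 z0) 0; first by rewrite !mulr0.
suff -> : s.[t] = 0 by rewrite mul0r.
have [||||[_ /eqP]|] := inj_nf t y0 z0 (D y0 z0 / (t + m) - m) y0 z0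
  (D y0 z0 / (t + m) ^+ 2).
- by rewrite mulf_neq0// invr_eq0 expf_eq0.
- apply/eqP; rewrite -subr_eq0; apply/eqP; rewrite /nf1.
  have -> : binquad P Q R y0 z0 = D y0 z0 - m ^+ 2 by rewrite /D addrC addKr.
  by field.
- have mE : binquad a b 0 y0 z0 = m * y0 by rewrite /binquad /m; ring.
  by rewrite /nf2 mE; field.
- have mE : binquad 0 a b y0 z0 = m * z0 by rewrite /binquad /m; ring.
  by rewrite /nf3 mE; field.
- rewrite mulrC (inj_eq (mulfI y0N0)) subr_eq => /eqP tE; case/eqP: Dsg.
  by rewrite -{1}(mulfVK sg0 (D y0 z0)) tE expr2 subrr.
- by rewrite sE.
Qed.

End TracelessDet.

(** * Birational maps have the normal form *)

Definition quad_form (K : comNzRingType) (V : 'M[K]_(3, 6)) (i : 'I_3) (x y z : K) :=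
  V i (inord 0) * x ^+ 2 + V i (inord 1) * (x * y) + V i (inord 2) * (x * z)
  + binquad (V i (inord 3)) (V i (inord 4)) (V i (inord 5)) y z.

Definition quad_fun (K : comNzRingType) (V : 'M[K]_(3, 6)) (u : 'I_3 -> K) : 'I_3 -> K :=
  fun i => quad_form V i (u (inord 0)) (u (inord 1)) (u (inord 2)).

(* The columns are f(e), and the coefficients of x y and x z in
   f(x e + (0, y, z)), for e = (1, al, be). *)
Definition shear_mx (K : comNzRingType) (al be : K) (V : 'M[K]_(3, 6)) : 'M[K]_3 :=
  \matrix_(i, j) tri (quad_form V i 1 al be)
    (V i (inord 1) + 2 * al * V i (inord 3) + be * V i (inord 4))
    (V i (inord 2) + al * V i (inord 4) + 2 * be * V i (inord 5)) j.

Lemma shear_mxE (K : comNzRingType) (al be : K) (V : 'M[K]_(3, 6)) i j :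
  shear_mx al be V i j = tri (quad_form V i 1 al be)
    (V i (inord 1) + 2 * al * V i (inord 3) + be * V i (inord 4))
    (V i (inord 2) + al * V i (inord 4) + 2 * be * V i (inord 5)) j.
Proof. by rewrite mxE. Qed.

(** The terms free of x, which the shear does not change. *)
Definition tail_mx (K : comNzRingType) (V : 'M[K]_(3, 6)) : 'M[K]_3 :=
  \matrix_(i, j) V i (inord (3 + j)).

Definition traceless_det_mx (K : numClosedFieldType) (W : 'M[K]_3) : Prop :=
  traceless_det (W (inord 0) (inord 0)) (W (inord 0) (inord 1)) (W (inord 0) (inord 2))
    (W (inord 1) (inord 0)) (W (inord 1) (inord 1)) (W (inord 1) (inord 2))
    (W (inord 2) (inord 0)) (W (inord 2) (inord 1)) (W (inord 2) (inord 2)).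

(** The first row of [W] holds the coefficients of p1, the other two those of the components of
    p. *)
Definition nf (K : comNzRingType) (W : 'M[K]_3) (x y z : K) : 'I_3 -> K :=
  fun i => x * tri x y z i + binquad (W i (inord 0)) (W i (inord 1)) (W i (inord 2)) y z.

Definition parallel (K : comNzRingType) (u v : 'I_3 -> K) :=
  forall i j, u i * v j = u j * v i.

Lemma sum3 (M : nmodType) (F : 'I_3 -> M) :
  \sum_i F i = F (inord 0) + F (inord 1) + F (inord 2).
Proof.
rewrite !big_ord_recl big_ord0 addr0 addrA.
by congr (F _ + F _ + F _); apply: val_inj; rewrite /= inordK.
Qed.

Lemma tri_inord (K : Type) (x y z : K) :
  (tri x y z (inord 0) = x) * (tri x y z (inord 1) = y) * (tri x y z (inord 2) = z).
Proof. by rewrite /tri !inordK. Qed.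

Lemma parallelZ (K : fieldType) (l : K) (u v : 'I_3 -> K) :
  l != 0 -> parallel (fun i => l * u i) v -> parallel u v.
Proof. by move=> l0 uv i j; apply: (mulfI l0); rewrite !mulrA. Qed.

Lemma parallel_trans (K : fieldType) (u v w : 'I_3 -> K) i0 :
  u i0 != 0 -> parallel u v -> parallel u w -> parallel v w.
Proof.
move=> ui uv uw i j; apply: (mulfI (mulf_neq0 ui ui)).
transitivity (u i0 * v i * (u i0 * w j)); first by ring.
transitivity (u i0 * v j * (u i0 * w i)); last by ring.
by rewrite !(uv i0) !(uw i0); ring.
Qed.

Section QuadraticMaps.
Variable K : numClosedFieldType.
Implicit Types (V : 'M[K]_(3, 6)) (W : 'M[K]_3) (u : 'I_3 -> K).

Lemma meval_quad_triple (v : 'rV[K]_18) u i :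
  meval u (tnth (quad_triple v) i) = quad_fun (vec_mx (v : 'rV_(3 * 6))) u i.
Proof.
rewrite tnth_mktuple raddf_sum/=.
pose F (j : nat) := vec_mx (v : 'rV_(3 * 6)) i (inord j) *
  meval u (nth 0 (quad_monomials K) j).
rewrite (eq_bigr (fun j : 'I_6 => F j)) => [|j _]; last first.
  by rewrite mevalZ /F inord_val (tnth_nth 0).
rewrite !big_ord_recl big_ord0 /F/= !mevalM !mevalXU /quad_fun /quad_form /binquad.
ring.
Qed.

Lemma quad_form_shear V i al be x y z :
  quad_form V i x (y + al * x) (z + be * x) =
  \sum_j shear_mx al be V i j * (x * tri x y z j) +
  (tail_mx V i (inord 0) * y ^+ 2 + tail_mx V i (inord 1) * (y * z)
   + tail_mx V i (inord 2) * z ^+ 2).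
Proof.
by rewrite sum3 !mxE !tri_inord !inordK// /quad_form /binquad; ring.
Qed.

Lemma quad_form_nf V i al be x y z : shear_mx al be V \in unitmx ->
  quad_form V i x (y + al * x) (z + be * x) =
  \sum_j shear_mx al be V i j * nf (invmx (shear_mx al be V) *m tail_mx V) x y z j.
Proof.
move=> U; rewrite quad_form_shear; set W := _ *m _.
have tailE j : tail_mx V i j = \sum_k shear_mx al be V i k * W k j.
  by rewrite -[in LHS](mulKVmx U (tail_mx V)) mxE.
by rewrite !tailE !sum3 /nf /binquad; ring.
Qed.

Definition vec_quad (v : 'rV[K]_18) : 'M[K]_(3, 6) := vec_mx (v : 'rV_(3 * 6)).

Lemma quad_triple_neq0 (v : 'rV[K]_18) : v != 0 -> exists i, tnth (quad_triple v) i != 0.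
Proof.
move=> v0; apply: contrapT => all0; case/eqP: v0.
have f0 i x y z : quad_form (vec_quad v) i x y z = 0.
  have -> : quad_form (vec_quad v) i x y z = quad_fun (vec_quad v) (tri x y z) i.
    by rewrite /quad_fun !tri_inord.
  rewrite -meval_quad_triple.
  have -> : tnth (quad_triple v) i = 0.
    by apply: contrapT => /eqP fi; apply: all0; exists i.
  by rewrite meval0.
apply: (can_inj (@vec_mxK K 3 6)); rewrite linear0; apply/matrixP => i j.
rewrite [RHS]mxE -/(vec_quad v).
(* The basis vectors give the coefficients of the squares, and their pairwise sums those of the
   mixed terms. *)
have := (f0 i 1 0 0, f0 i 0 1 0, f0 i 0 0 1, f0 i 1 1 0, f0 i 1 0 1, f0 i 0 1 1).
rewrite /quad_form /binquad !(expr1n, expr0n, mulr0, mul0r, mulr1, addr0, add0r)/=.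
move=> [[[[[]]]]] V0 V3 V5; rewrite V0 V3 V5 !(add0r, addr0) => V1 V2 V4.
have -> : j = inord j by rewrite inord_val.
by case: j => [[|[|[|[|[|[|]]]]]]]/=.
Qed.

(* G inverts f up to a common factor; f need not be reduced. *)
Definition left_inverse m (f : 3.-tuple (mpoly 3 K)) (G : 3.-tuple (mpoly 3 K)) :=
  [/\ forall i, tnth G i \is ishomog1 m mdeg,
      forall u, parallel (fun i => meval u (comp_mpoly f (tnth G i))) u
    & exists i, comp_mpoly f (tnth G i) != 0].

(** If f = D g and G is homogeneous of degree m, then G(f) = D^m G(g), so an inverse of the reduced
    map inverts f up to a factor. *)
Lemma birational_left_inverse (v : 'rV[K]_18) g :
  v != 0 -> is_reduced_map (quad_triple v) g -> birational g ->
  exists m G, left_inverse m (quad_triple v) G.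
Proof.
move=> v0 [D [_ fE]] [_ [G [[[m Gm] _] [i0 Gg0] Ggx _ _]]].
have D0 : D != 0.
  have [k] := quad_triple_neq0 v0; rewrite fE; apply: contra_neq => ->.
  by rewrite mul0r.
have compE u i : meval u (comp_mpoly (quad_triple v) (tnth G i)) =
    meval u D ^+ m * meval u (comp_mpoly g (tnth G i)).
  rewrite !comp_mpoly_meval -meval_homog//.
  by apply: meval_eq => j; rewrite fE mevalM.
exists m, G; split=> //.
- move=> u i j; rewrite (compE u i) (compE u j).
  have /(congr1 (meval u)) := Ggx i j.
  rewrite !tnth_mktuple !mevalM !mevalXU.
  move: (meval u (comp_mpoly g (tnth G i))) (meval u (comp_mpoly g (tnth G j))).
  by move=> a b E; rewrite -mulrA E mulrA.
- exists i0; move: Gg0; rewrite tnth_mktuple => Gg0.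
  have [u] := mpoly_neq0_point (mulf_neq0 D0 Gg0).
  rewrite mevalM mulf_eq0 negb_or => /andP[Du Gu].
  apply: contraNneq (mulf_neq0 (expf_neq0 m Du) Gu) => comp0.
  by rewrite -compE comp0 meval0.
Qed.

Lemma unitmx_ker0 n (A : 'M[K]_n) :
  (forall u : 'cV_n, A *m u = 0 -> u = 0) -> A \in unitmx.
Proof.
move=> A0; rewrite -unitmx_tr -row_free_unit -kermx_eq0; apply/eqP/eqP.
apply/rowV0P => w /sub_kermxP wA; apply: trmx_inj; rewrite trmx0; apply: A0.
by rewrite -[A]trmxK -trmx_mul wA trmx0.
Qed.

Lemma shear_unit_exists (v : 'rV[K]_18) m G :
  left_inverse m (quad_triple v) G ->
  exists al be, shear_mx al be (vec_quad v) \in unitmx.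
Proof.
move=> [Gm Gpar [i0 G0]].
pose f := quad_fun (vec_quad v).
pose q u i := meval (f u) (tnth G i).
have qE u i : meval u (comp_mpoly (quad_triple v) (tnth G i)) = q u i.
  by rewrite comp_mpoly_meval; apply: meval_eq => j; rewrite meval_quad_triple.
have qpar u : parallel (q u) u by move=> i j; have := Gpar u i j; rewrite !qE.
have X0 : mpolyX K (mnm1 (inord 0 : 'I_3)) != 0.
  apply: contra_neq (oner_neq0 K) => X0.
  by rewrite -[LHS](meval_X (i := 0) 1 0 0)// X0 meval0.
(* A nonzero first coordinate allows [u] to be rescaled to e = (1, al, be). *)
have [u] := mpoly_neq0_point (mulf_neq0 X0 G0).
rewrite mevalM mevalXU qE mulf_eq0 negb_or => /andP[u0 qu].
pose al := u (inord 1) / u (inord 0); pose be := u (inord 2) / u (inord 0).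
have qe : q (tri 1 al be) i0 != 0.
  apply: contraNneq qu => qe.
  rewrite /q (@meval_eq _ _ _ (fun i => u (inord 0) ^+ 2 * f (tri 1 al be) i)).
    by rewrite (meval_homog _ _ (Gm i0)) -/(q _ _) qe mulr0.
  move=> i; rewrite /f /quad_fun !tri_inord /al /be /quad_form /binquad.
  by field.
exists al, be; apply: unitmx_ker0 => w /matrixP Sw.
set S := shear_mx al be (vec_quad v) in Sw.
have {}Sw i : \sum_j S i j * w j 0 = 0 by have := Sw i 0; rewrite !mxE.
pose c i := f (tri 1 al be) i.
(* This is w_0 e + 2 (0, w_1, w_2). The derivative of f at e along it is 2 S w = 0, because the
   first column of S is f(e), half the derivative along e. Hence f(e + t dir) = f(e) + t^2
   f(dir). *)
pose dir := tri (w (inord 0) 0) (al * w (inord 0) 0 + 2 * w (inord 1) 0)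
  (be * w (inord 0) 0 + 2 * w (inord 2) 0).
have feE t i : f (fun j => tri 1 al be j + t * dir j) i = c i + t ^+ 2 * f dir i.
  rewrite -[LHS]addr0 -(mulr0 (- (2 * t))) -(Sw i) sum3 /S !shear_mxE !tri_inord.
  rewrite /c /f /quad_fun /dir !tri_inord /quad_form /binquad; ring.
have qeE i : exists s : {poly K},
    forall t, q (fun j => tri 1 al be j + t * dir j) i = s.[t ^+ 2].
  have [s sE] := meval_curve (tnth G i) (fun j => (c j)%:P + (f dir j)%:P * 'X).
  exists s => t; rewrite sE; apply: meval_eq => j.
  by rewrite feE hornerD hornerM !hornerC hornerX mulrC.
(* As a function of t, q(e + t dir) is even, so it is parallel to both e + t dir and e - t dir.
   Subtracting the two relations leaves t times a relation with [dir]; after cancelling t, set t =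
   0. *)
have parq : parallel (q (tri 1 al be)) dir.
  move=> i j; have [si siE] := qeE i; have [sj sjE] := qeE j.
  have q0 k (s : {poly K}) : (forall t,
      q (fun j => tri 1 al be j + t * dir j) k = s.[t ^+ 2]) ->
      q (tri 1 al be) k = s.[0].
    move=> sE; have := sE 0; rewrite expr0n => <-; apply: meval_eq => l.
    rewrite /f /quad_fun; congr quad_form; by rewrite mul0r addr0.
  rewrite (q0 i si)// (q0 j sj)//.
  pose p := ((si * (dir j)%:P - sj * (dir i)%:P) \Po 'X^2).
  have p0 : p * 'X = 0.
    apply: poly_fun_eq0 => t; rewrite /p hornerM horner_comp hornerXn hornerX.
    rewrite hornerD hornerN !hornerM !hornerC.
    have := qpar (fun j => tri 1 al be j + t * dir j) i j.
    have := qpar (fun j => tri 1 al be j + (- t) * dir j) i j.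
    rewrite !siE !sjE sqrrN.
    move: si.[_] sj.[_] (tri _ _ _ i) (tri _ _ _ j) => a b ei ej E2 E1.
    have twoN0 : 2 != 0 :> K by rewrite pnatr_eq0.
    apply: (mulfI twoN0); rewrite mulr0.
    transitivity ((a * (ej + t * dir j) - b * (ei + t * dir i))
      - (a * (ej + - t * dir j) - b * (ei + - t * dir i))); first by ring.
    by rewrite E1 E2 !subrr.
  move/eqP: p0; rewrite mulf_eq0 polyX_eq0 orbF => /eqP /(congr1 (horner^~ 0)).
  rewrite /p horner_comp hornerXn expr0n/= horner0 hornerD hornerN !hornerM.
  by rewrite !hornerC => /eqP; rewrite subr_eq0 => /eqP.
have pare := parallel_trans qe (qpar _) parq.
have w1 : w (inord 1) 0 = 0.
  have := pare (inord 0) (inord 1); rewrite /dir !tri_inord mul1r => E.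
  apply: (mulfI (_ : 2 != 0 :> K)); first by rewrite pnatr_eq0.
  by apply: (addrI (al * w (inord 0) 0)); rewrite E mulr0 addr0.
have w2 : w (inord 2) 0 = 0.
  have := pare (inord 0) (inord 2); rewrite /dir !tri_inord mul1r => E.
  apply: (mulfI (_ : 2 != 0 :> K)); first by rewrite pnatr_eq0.
  by apply: (addrI (be * w (inord 0) 0)); rewrite E mulr0 addr0.
suff w0 : w (inord 0) 0 = 0.
  apply/colP => i; rewrite mxE; have -> : i = inord i by rewrite inord_val.
  by case: i => [[|[|[|]]]].
apply: contrapT => /eqP w0.
have c0 i : c i = 0.
  have /eqP := Sw i; rewrite sum3 w1 w2 !mulr0 !addr0 mulf_eq0 (negPf w0) orbF.
  by move/eqP; rewrite /S shear_mxE tri_inord /c /f /quad_fun !tri_inord.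
(* Here f(e) = 0 while G(f(e)) is nonzero, so G is constant. Then q is a nonzero constant vector
   parallel to every vector, which is absurd. *)
have m0 : m = 0%N.
  apply: contrapT => /eqP m0; case/eqP: qe.
  rewrite /q (@meval_eq _ _ _ (fun i => 0 * c i)) => [|i]; last first.
    by rewrite mul0r -[LHS]/(c i) c0.
  by rewrite (meval_homog _ _ (Gm i0)) expr0n (negPf m0) mul0r.
have qcst u' i : q u' i = q (tri 1 al be) i.
  have G0E u'' : q u'' i = meval (fun=> 0) (tnth G i).
    rewrite -[LHS]mul1r -[1](expr0 0) -[in 0 ^+ _]m0 -(meval_homog _ _ (Gm i)).
    by apply: meval_eq => j; rewrite mul0r.
  by rewrite !G0E.
have := parallel_trans (u := q (tri 1 al be)) qe (qpar _).
have qpar' u' : parallel (q (tri 1 al be)) u'.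
  by move=> i j; have := qpar u' i j; rewrite !(qcst u').
move=> /(_ _ (qpar' (tri 0 1 0))) /(_ (inord 0) (inord 1)).
by rewrite !tri_inord mulr1 mulr0 => /eqP; rewrite oner_eq0.
Qed.

End QuadraticMaps.

Lemma ord3P (P : 'I_3 -> Prop) :
  P (inord 0) -> P (inord 1) -> P (inord 2) -> forall i, P i.
Proof.
move=> P0 P1 P2 i; have -> : i = inord i by rewrite inord_val.
by case: i => [[|[|[|]]]].
Qed.

Section Shear.
Variable K : numClosedFieldType.
Local Notation X i := (mpolyX K (mnm1 (inord i : 'I_3))).

Definition shear_tuple (al be : K) : 3.-tuple (mpoly 3 K) :=
  [tuple tri (X 0) (X 1 + al *: X 0) (X 2 + be *: X 0) i | i < 3].

Lemma meval_shear al be (p : mpoly 3 K) x y z :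
  meval (tri x y z) (comp_mpoly (shear_tuple al be) p) =
  meval (tri x (y + al * x) (z + be * x)) p.
Proof.
rewrite comp_mpoly_meval; apply: meval_eq => i; rewrite tnth_mktuple.
by move: i; apply: ord3P; rewrite !tri_inord ?mevalD ?mevalZ !mevalXU !tri_inord.
Qed.

Lemma left_inverse_traceless (v : 'rV[K]_18) m G al be :
  left_inverse m (quad_triple v) G ->
  shear_mx al be (vec_quad v) \in unitmx ->
  traceless_det_mx (invmx (shear_mx al be (vec_quad v)) *m tail_mx (vec_quad v)).
Proof.
move=> [Gm Gpar [i0 G0]] U; set W := _ *m _.
pose f := quad_fun (vec_quad v).
pose q u i := meval (f u) (tnth G i).
have qE u i : meval u (comp_mpoly (quad_triple v) (tnth G i)) = q u i.
  by rewrite comp_mpoly_meval; apply: meval_eq => j; rewrite meval_quad_triple.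
have qpar u : parallel (q u) u by move=> i j; have := Gpar u i j; rewrite !qE.
pose T x y z := tri x (y + al * x) (z + be * x).
(* A component of G(f) in the sheared coordinates; off its zero set, f determines the point up to
   scaling. *)
pose th := comp_mpoly (shear_tuple al be) (comp_mpoly (quad_triple v) (tnth G i0)).
have thE x y z : meval (tri x y z) th = q (T x y z) i0 by rewrite meval_shear qE.
apply: (@traceless_det_of_inj _ _ _ _ _ _ _ _ _ _ th).
  have [u] := mpoly_neq0_point G0; rewrite qE; apply: contra_neq => th0.
  rewrite (triE u); move: (u (inord 0)) (u (inord 1)) (u (inord 2)) => x y z.
  by have := thE x (y - al * x) (z - be * x); rewrite /T !subrK th0 meval0 => <-.
move=> x y z x' y' z' lam lam0 E1 E2 E3.
have nfE i : nf W x' y' z' i = lam * nf W x y z i.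
  by move: i; apply: ord3P; rewrite /nf !tri_inord -?expr2.
have fE i : f (T x' y' z') i = lam * f (T x y z) i.
  rewrite /f /quad_fun /T !tri_inord !quad_form_nf// -/W mulr_sumr.
  by apply: eq_bigr => j _; rewrite nfE mulrCA.
have qlam i : q (T x' y' z') i = lam ^+ m * q (T x y z) i.
  rewrite /q -(meval_homog _ _ (Gm i)); exact: meval_eq.
have [q0|q0] := eqVneq (q (T x y z) i0) 0; first by right; rewrite thE.
left; have qpar' : parallel (q (T x y z)) (T x' y' z').
  apply: (@parallelZ _ (lam ^+ m)); first by rewrite expf_neq0.
  by move=> i j; rewrite -!qlam; apply: qpar.
have par := parallel_trans q0 (qpar _) qpar'.
have := (par (inord 0) (inord 1), par (inord 0) (inord 2), par (inord 1) (inord 2)).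
rewrite /T !tri_inord => -[[E01 E02] E12].
have F01 : x' * y = y' * x.
  apply/eqP; rewrite -subr_eq0; apply/eqP.
  transitivity ((y + al * x) * x' - x * (y' + al * x')); first by ring.
  by rewrite E01 subrr.
have F02 : x' * z = z' * x.
  apply/eqP; rewrite -subr_eq0; apply/eqP.
  transitivity ((z + be * x) * x' - x * (z' + be * x')); first by ring.
  by rewrite E02 subrr.
split=> //; apply/eqP; rewrite -subr_eq0; apply/eqP.
transitivity ((z + be * x) * (y' + al * x') - (y + al * x) * (z' + be * x')
  + be * (x' * y - y' * x) - al * (x' * z - z' * x)); first by ring.
by rewrite E12 F01 F02 !subrr !mulr0 addr0 subr0.
Qed.

End Shear.

(** * Inverting the normal form *)

Section Divisibility.
Variable K : numDomainType.
Local Notation X i := (mpolyX K (mnm1 (i : 'I_3))).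
Implicit Types (p q r : mpoly 3 K) (u dir : 'I_3 -> K).

Definition translate dir p : mpoly 3 K :=
  comp_mpoly [tuple X i + mpolyC 3 (dir i) | i < 3] p.

Lemma meval_translate dir p u :
  meval u (translate dir p) = meval (fun i => u i + dir i) p.
Proof.
rewrite comp_mpoly_meval; apply: meval_eq => i.
by rewrite tnth_mktuple mevalD mevalXU mevalC.
Qed.

Lemma translateM dir p q : translate dir (p * q) = translate dir p * translate dir q.
Proof. by apply: mpoly_fun_inj => u; rewrite mevalM !meval_translate mevalM. Qed.

End Divisibility.

(* On each line of direction dir, the divisor of a nonzero constant is constant. *)
Lemma dvd_translate_inv (K : numFieldType) (p r : mpoly 3 K) dir :
  p * r != 0 ->
  (forall u t, meval (fun i => u i + t * dir i) (p * r) = meval u (p * r)) ->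
  translate dir p = p.
Proof.
move=> pr0 pr_inv; apply/eqP; rewrite -subr_eq0.
suff /eqP : (translate dir p - p) * (p * r) = 0.
  by rewrite mulf_eq0 (negPf pr0) orbF.
apply: mpoly_fun_eq0 => u.
rewrite mevalM mevalB meval_translate.
have [->|Cu] := eqVneq (meval u (p * r)) 0; first by rewrite mulr0.
have [s sE] := meval_curve p (fun i => (u i)%:P + 'X * (dir i)%:P).
have [s' s'E] := meval_curve r (fun i => (u i)%:P + 'X * (dir i)%:P).
have curveE t : (fun i => ((u i)%:P + 'X * (dir i)%:P).[t]) = (fun i => u i + t * dir i).
  by apply/funext => i; rewrite hornerD hornerM !hornerC hornerX.
have ss' : s * s' = (meval u (p * r))%:P.
  apply/eqP; rewrite -subr_eq0; apply/eqP/poly_fun_eq0 => t.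
  by rewrite hornerD hornerN hornerM hornerC sE s'E curveE -mevalM pr_inv subrr.
have /eqP s1 : size s == 1%N.
  have := size_polyC (meval u (p * r)); rewrite -ss' Cu.
  by move/eqP; rewrite size_mul_eq1 => /andP[].
have [k sk] : exists k, s = k%:P by exists s`_0; apply: size1_polyC; rewrite s1.
have sk_u t : meval (fun i => u i + t * dir i) p = k.
  by rewrite -(curveE t) -sE sk hornerC.
rewrite (@meval_eq _ _ _ (fun i => u i + 1 * dir i)) => [|i]; last by rewrite mul1r.
rewrite (@meval_eq _ _ u (fun i => u i + 0 * dir i)) => [|i]; last first.
  by rewrite mul0r addr0.
rewrite !sk_u.
by rewrite subrr mul0r.
Qed.

(** Translation fixes [p], so it acts on the quotient alone. Finite differences thus lower the
    degree of the multiples of a common divisor. *)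
Lemma mdvd_translateB (K : numFieldType) (p q : mpoly 3 K) dir :
  translate dir p = p -> mdvd p q -> mdvd p (translate dir q - q).
Proof.
move=> pE [r ->]; exists (translate dir r - r).
by rewrite translateM pE mulrBr.
Qed.

Lemma mdvd_sum (K : numFieldType) (I : Type) (s : seq I) (c : I -> mpoly 3 K) p q :
  (forall i, mdvd p (q i)) -> mdvd p (\sum_(i <- s) c i * q i).
Proof.
move=> pq; elim: s => [|i s [r IHs]]; first by exists 0; rewrite big_nil mulr0.
have [r' r'E] := pq i; exists (c i * r' + r).
by rewrite big_cons IHs r'E mulrDr mulrCA.
Qed.

Section Linear.
Variable K : numFieldType.
Local Notation X i := (mpolyX K (mnm1 (i : 'I_3))).

Definition lin_tuple (A : 'M[K]_3) : 3.-tuple (mpoly 3 K) :=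
  [tuple \sum_j A i j *: X j | i < 3].

Lemma meval_lin_tuple A u i : meval u (tnth (lin_tuple A) i) = \sum_j A i j * u j.
Proof.
rewrite tnth_mktuple raddf_sum; apply: eq_bigr => j _.
by rewrite /= mevalZ mevalXU.
Qed.

Lemma homog_X (i : 'I_3) : X i \is ishomog1 1 mdeg.
Proof. by rewrite dhomogX; apply/eqP; exact: mdeg1. Qed.

Lemma homog_lin_tuple A i : tnth (lin_tuple A) i \is ishomog1 1 mdeg.
Proof. by rewrite tnth_mktuple rpred_sum// => j _; rewrite rpredZ ?homog_X. Qed.

Lemma lin_tuple_inv A : A \in unitmx ->
  ratmap_comp (lin_tuple (invmx A)) (lin_tuple A) = ratmap_id K.
Proof.
move=> U; apply: eq_from_tnth => i; rewrite [LHS]tnth_mktuple [RHS]tnth_mktuple.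
apply: mpoly_fun_inj => u; rewrite comp_mpoly_meval mevalXU meval_lin_tuple.
pose w : 'cV_3 := \col_j u j.
have Aw j : meval u (tnth (lin_tuple A) j) = (A *m w) j 0.
  by rewrite meval_lin_tuple mxE; apply: eq_bigr => k _; rewrite mxE.
transitivity ((invmx A *m (A *m w)) i 0); last by rewrite mulKmx// mxE.
by rewrite mxE; apply: eq_bigr => j _; rewrite Aw.
Qed.

Lemma ratmap_id_neq0 : tuple_neq0 (ratmap_id K).
Proof.
exists (inord 0); rewrite tnth_mktuple; apply: contra_neq (oner_neq0 K) => X0.
by rewrite -[LHS](mevalXU (fun=> 1) (inord 0 : 'I_3)) X0 meval0.
Qed.

Lemma lin_tuple_ratmap A : A \in unitmx -> is_ratmap (lin_tuple A).
Proof.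
move=> U; split; first by exists 1%N => i; exact: homog_lin_tuple.
apply: contrapT => A0; have [k] := ratmap_id_neq0; case/eqP.
rewrite -(lin_tuple_inv U) tnth_mktuple; apply: mpoly_fun_inj => u.
rewrite comp_mpoly_meval meval_lin_tuple big1 ?meval0// => j _.
have -> : tnth (lin_tuple A) j = 0; last by rewrite meval0 mulr0.
by apply: contrapT => /eqP Aj; apply: A0; exists j.
Qed.

Lemma lin_tuple_birational A : A \in unitmx -> birational (lin_tuple A).
Proof.
move=> U; split; first exact: lin_tuple_ratmap.
have U' : invmx A \in unitmx by rewrite unitmx_inv.
exists (lin_tuple (invmx A)); have := lin_tuple_inv U'; rewrite invmxK => ->.
rewrite lin_tuple_inv//; split; try exact: ratmap_id_neq0.
- exact: lin_tuple_ratmap.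
- by move=> i j; rewrite mulrC.
- by move=> i j; rewrite mulrC.
Qed.

End Linear.

(* With p = (nf2, nf3) at x = 0 and N as above, y = nf(x, w) satisfies
   y1 w = (x - N(w)) (y2, y3), which is a pair of linear equations in (x, w) with
   coefficients linear in y; this is the cross product of these coefficient rows. *)
Definition nf_inverse (K : comNzRingType) (W : 'M[K]_3) (x y z : K) : 'I_3 -> K :=
  let a := W (inord 1) (inord 0) in let b := W (inord 1) (inord 1) in
  let c := W (inord 1) (inord 2) in let d := W (inord 2) (inord 0) in
  let e := W (inord 2) (inord 1) in let f := W (inord 2) (inord 2) in
  let p := f * y - c * z in
  let q := a * y + (b + f) * z + x in
  let r := a * z - d * y in
  let s := (e + a) * y + f * z + x in
  tri (q * s - p * r) (p * z + y * s) (y * r + q * z).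

Lemma traceless_detE (K : numClosedFieldType) (P Q R a b c d e f : K) :
  traceless_det P Q R a b c d e f ->
  [/\ P = - (a ^+ 2 + d * (b + f)),
      Q = 2 * a * f - (b + f) * (e + a) - c * d
    & R = - (f ^+ 2 + c * (e + a))].
Proof.
by case=> hP hQ hR; split; apply/eqP; rewrite -subr_eq0; apply/eqP;
  [rewrite -[RHS]hP | rewrite -[RHS]hQ | rewrite -[RHS]hR]; ring.
Qed.

Section Converse.
Variable K : numClosedFieldType.
Local Notation X i := (mpolyX K (mnm1 (inord i : 'I_3))).

Lemma nf_inverseK (W : 'M[K]_3) x y z : traceless_det_mx W ->
  parallel (nf_inverse W (nf W x y z (inord 0)) (nf W x y z (inord 1))
    (nf W x y z (inord 2))) (tri x y z).
Proof.
case/traceless_detE => hP hQ hR.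
by apply: ord3P; apply: ord3P; rewrite // /nf_inverse /nf !tri_inord /binquad ?hP ?hQ ?hR;
  ring.
Qed.

Lemma nfK (W : 'M[K]_3) x y z : traceless_det_mx W ->
  let g := nf_inverse W x y z in
  parallel (nf W (g (inord 0)) (g (inord 1)) (g (inord 2))) (tri x y z).
Proof.
case/traceless_detE => hP hQ hR.
by apply: ord3P; apply: ord3P; rewrite // /nf_inverse /nf !tri_inord /binquad ?hP ?hQ ?hR;
  ring.
Qed.

Lemma meval_nf_inverse (W : 'M[K]_3) (p q r : mpoly 3 K) u i :
  meval u (nf_inverse (map_mx (@mpolyC 3 K) W) p q r i) =
  nf_inverse W (meval u p) (meval u q) (meval u r) i.
Proof.
move: i; apply: ord3P; rewrite /nf_inverse !tri_inord !mxE;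
by rewrite !(mevalD, mevalN, mevalM, mevalC).
Qed.

Lemma ratmap_compE (g h : 3.-tuple (mpoly 3 K)) i :
  tnth (ratmap_comp g h) i = comp_mpoly h (tnth g i).
Proof. exact: tnth_mktuple. Qed.

Lemma ratmap_idE i : tnth (ratmap_id K) i = mpolyX K (mnm1 i).
Proof. exact: tnth_mktuple. Qed.

Lemma homogM11 (p q : mpoly 3 K) :
  p \is ishomog1 1 mdeg -> q \is ishomog1 1 mdeg -> p * q \is ishomog1 2 mdeg.
Proof. by move=> hp hq; exact: (dhomogM hp hq). Qed.

Lemma homog_nf_inverse (W : 'M[K]_3) (p q r : mpoly 3 K) i :
  p \is ishomog1 1 mdeg -> q \is ishomog1 1 mdeg -> r \is ishomog1 1 mdeg ->
  nf_inverse (map_mx (@mpolyC 3 K) W) p q r i \is ishomog1 2 mdeg.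
Proof.
move=> hp hq hr; move: i; apply: ord3P; rewrite /nf_inverse !tri_inord !mxE;
rewrite -?mpolyCD !mul_mpolyC;
by rewrite !(rpredD, rpredN, homogM11, rpredZ).
Qed.

Section Quadratic.
Variables (v : 'rV[K]_18) (al be : K).
Let S := shear_mx al be (vec_quad v).
Hypothesis U : S \in unitmx.
Let W := invmx S *m tail_mx (vec_quad v).

Lemma meval_quad_nf u i : meval u (tnth (quad_triple v) i) =
  \sum_j S i j * nf W (u (inord 0)) (u (inord 1) - al * u (inord 0))
                      (u (inord 2) - be * u (inord 0)) j.
Proof. by rewrite meval_quad_triple /quad_fun -quad_form_nf// !subrK. Qed.

Lemma nf_meval_quad u i :
  \sum_j invmx S i j * meval u (tnth (quad_triple v) j) =
  nf W (u (inord 0)) (u (inord 1) - al * u (inord 0))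
     (u (inord 2) - be * u (inord 0)) i.
Proof.
set w := nf W _ _ _; pose wc : 'cV_3 := \col_j w j.
transitivity ((invmx S *m (S *m wc)) i 0); last by rewrite mulKmx// mxE.
rewrite mxE; apply: eq_bigr => j _; congr (_ * _); rewrite meval_quad_nf [RHS]mxE.
by apply: eq_bigr => k _; congr (_ * _); rewrite mxE.
Qed.

Lemma homog_quad_triple i : tnth (quad_triple v) i \is ishomog1 2 mdeg.
Proof.
rewrite tnth_mktuple rpred_sum// => j _; rewrite rpredZ//.
have hX (k l : 'I_3) : mpolyX K (mnm1 k) * mpolyX K (mnm1 l) \is ishomog1 2 mdeg.
  by apply: homogM11; exact: homog_X.
by rewrite (tnth_nth 0); case: j => [[|[|[|[|[|[|]]]]]]]//= _; apply: hX.
Qed.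

Lemma quad_triple_unit_neq0 u :
  u = tri 1 al be -> exists i, meval u (tnth (quad_triple v) i) != 0.
Proof.
move=> uE; apply: contrapT => f0.
have := nf_meval_quad u (inord 0); rewrite big1 => [|j _]; last first.
  have -> : meval u (tnth (quad_triple v) j) = 0; last by rewrite mulr0.
  by apply: contrapT => /eqP fj; apply: f0; exists j.
rewrite uE !tri_inord !mulr1 !subrr /nf !tri_inord /binquad.
by rewrite !expr0n !mulr0 !addr0 mulr1 => /eqP; rewrite eq_sym oner_eq0.
Qed.

(** Undoes in turn the change of target, the normal form and the shear of the source. *)
Definition quad_inverse : 3.-tuple (mpoly 3 K) :=
  let L := lin_tuple (invmx S) in
  let g := nf_inverse (map_mx (@mpolyC 3 K) W)
             (tnth L (inord 0)) (tnth L (inord 1)) (tnth L (inord 2)) in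
  [tuple tri (g (inord 0)) (g (inord 1) + al *: g (inord 0))
             (g (inord 2) + be *: g (inord 0)) i | i < 3].

Lemma meval_quad_inverse u i : meval u (tnth quad_inverse i) =
  let y j := \sum_k invmx S j k * u k in
  let g := nf_inverse W (y (inord 0)) (y (inord 1)) (y (inord 2)) in
  tri (g (inord 0)) (g (inord 1) + al * g (inord 0))
      (g (inord 2) + be * g (inord 0)) i.
Proof.
rewrite tnth_mktuple /=; move: i; apply: ord3P; rewrite !tri_inord;
by rewrite ?mevalD ?mevalZ !meval_nf_inverse !meval_lin_tuple.
Qed.

Lemma homog_quad_inverse i : tnth quad_inverse i \is ishomog1 2 mdeg.
Proof.
rewrite tnth_mktuple; move: i; apply: ord3P; rewrite !tri_inord.
- by rewrite homog_nf_inverse ?homog_lin_tuple.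
- by rewrite rpredD ?rpredZ// homog_nf_inverse ?homog_lin_tuple.
- by rewrite rpredD ?rpredZ// homog_nf_inverse ?homog_lin_tuple.
Qed.

Lemma parallel_shear (g : 'I_3 -> K) x y z : parallel g (tri x y z) ->
  parallel (tri (g (inord 0)) (g (inord 1) + al * g (inord 0))
                (g (inord 2) + be * g (inord 0)))
           (tri x (y + al * x) (z + be * x)).
Proof.
move=> par; have := (par (inord 0) (inord 1), par (inord 0) (inord 2),
  par (inord 1) (inord 2)); rewrite !tri_inord => -[[E1 E2] E3].
have F1 : g (inord 1) * x = g (inord 0) * y by rewrite E1.
have F2 : g (inord 2) * x = g (inord 0) * z by rewrite E2.
have F3 : g (inord 2) * y = g (inord 1) * z by rewrite E3.
by apply: ord3P; apply: ord3P; rewrite ?tri_inord// !(mulrDl, mulrDr);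
  rewrite ?(mulrCA _ al) ?(mulrCA _ be) -?[al * _ * _]mulrA -?[be * _ * _]mulrA
     ?(mulrCA _ al) ?(mulrCA _ be) ?F1 ?F2 ?F3; ring.
Qed.

Lemma quad_triple_birational : traceless_det_mx W -> birational (quad_triple v).
Proof.
move=> tW.
(* The composite is tested at f(e), the first column of S: there [quad_inverse] takes the value e,
   and f(e) is nonzero. *)
have f0 : exists i, comp_mpoly quad_inverse (tnth (quad_triple v) i) != 0.
  have [i fi] := quad_triple_unit_neq0 erefl; exists i.
  apply: contra_neq fi => fi.
  have := congr1 (meval (fun k => S k (inord 0))) fi.
  rewrite meval0 comp_mpoly_meval => <-; apply: meval_eq => j.
  rewrite meval_quad_inverse.
  have yE k : \sum_l invmx S k l * S l (inord 0) = (k == inord 0)%:R.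
    by have := congr1 (fun A : 'M[K]_3 => A k (inord 0)) (mulVmx U); rewrite !mxE.
  rewrite /nf_inverse/= !yE -!val_eqE/= !inordK//= !tri_inord.
  by move: j; apply: ord3P; rewrite !tri_inord; ring.
have g0 : comp_mpoly (quad_triple v) (tnth quad_inverse (inord 0)) != 0.
  apply: contra_neq (oner_neq0 K) => /(congr1 (meval (tri 1 al be))).
  rewrite meval0 comp_mpoly_meval meval_quad_inverse/= => <-.
  rewrite !nf_meval_quad !tri_inord !mulr1 !subrr /nf_inverse /nf !tri_inord /binquad.
  ring.
have nz (h k : 3.-tuple (mpoly 3 K)) i : comp_mpoly h (tnth k i) != 0 -> tuple_neq0 k.
  by move=> hk; exists i; apply: contra_neq hk => ->; rewrite /comp_mpoly mmap0.
split.
  split; first by exists 2%N => i; exact: homog_quad_triple.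
  by have [i fi] := f0; exact: nz fi.
exists quad_inverse; split.
- split; first by exists 2%N => i; exact: homog_quad_inverse.
  exact: nz g0.
- by exists (inord 0); rewrite tnth_mktuple.
- move=> i j; apply: mpoly_fun_inj => u.
  rewrite !mevalM !ratmap_compE !ratmap_idE !comp_mpoly_meval !mevalXU.
  rewrite !meval_quad_inverse/= !nf_meval_quad.
  have := parallel_shear (nf_inverseK (u (inord 0)) (u (inord 1) - al * u (inord 0))
                      (u (inord 2) - be * u (inord 0)) tW).
  by rewrite !subrK -triE; apply.
- by have [i fi] := f0; exists i; rewrite tnth_mktuple.
- move=> i j; apply: mpoly_fun_inj => u.
  rewrite !mevalM !ratmap_compE !ratmap_idE !comp_mpoly_meval !mevalXU !meval_quad_nf.
  rewrite !meval_quad_inverse/= !tri_inord !addrK.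
  set y := fun j => \sum_k invmx S j k * u k.
  have par := nfK (y (inord 0)) (y (inord 1)) (y (inord 2)) tW.
  (* Both f(g(u)) and u are images under S of vectors that [par] makes parallel. *)
  have uE k : u k = \sum_l S k l * tri (y (inord 0)) (y (inord 1)) (y (inord 2)) l.
    rewrite -triE; pose w : 'cV_3 := \col_l u l.
    transitivity ((S *m (invmx S *m w)) k 0); first by rewrite mulKVmx// mxE.
    rewrite mxE; apply: eq_bigr => l _; congr (_ * _); rewrite mxE.
    by apply: eq_bigr => k' _; rewrite mxE.
  rewrite (uE i) (uE j) !big_distrlr/= exchange_big/=.
  apply: eq_bigr => k _; apply: eq_bigr => l _.
  by rewrite mulrACA (par l k) [RHS]mulrACA; congr (_ * _); rewrite mulrC.
Qed.

End Quadratic.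
End Converse.

(** * Common divisors and the reduced map *)

Section Reduced.
Variable K : numClosedFieldType.
Local Notation X i := (mpolyX K (mnm1 (inord i : 'I_3))).
Variables (v : 'rV[K]_18) (al be : K).
Let S := shear_mx al be (vec_quad v).
Hypothesis U : S \in unitmx.
Let W := invmx S *m tail_mx (vec_quad v).
Hypothesis tW : traceless_det_mx W.
Let f := quad_triple v.
Let Yc : mpoly 3 K := X 1 - al *: X 0.
Let Zc : mpoly 3 K := X 2 - be *: X 0.
Let nfp (i : 'I_3) : mpoly 3 K := \sum_j mpolyC 3 (invmx S i j) * tnth f j.

Let evE := (mevalM, mevalB, mevalD, mevalZ, mevalXU, mevalC, meval1).

Lemma meval_nfp u i : meval u (nfp i) =
  nf W (u (inord 0)) (u (inord 1) - al * u (inord 0)) (u (inord 2) - be * u (inord 0)) i.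
Proof.
rewrite /nfp raddf_sum/= -nf_meval_quad//; apply: eq_bigr => j _.
by rewrite mevalM mevalC.
Qed.

Let cub : mpoly 3 K := Zc * nfp (inord 1) - Yc * nfp (inord 2).

(** The terms in x cancel in [cub], so it is invariant under translation along e. A common divisor p
    of f divides [cub] and inherits this invariance, hence divides the second difference along e of
    x^2 + p1(w), which is the constant 2. *)
Lemma gcd1_of_cubic : cub != 0 -> is_gcd 1 f.
Proof.
move=> cub0; split=> [i|p pf]; first by exists (tnth f i); rewrite mul1r.
have pnf i : mdvd p (nfp i) by apply: mdvd_sum.
pose dir := tri 1 al be.
have pE : translate dir p = p.
  have [[r1 r1E] [r2 r2E]] := (pnf (inord 1), pnf (inord 2)).
  have cubE : cub = p * (Zc * r1 - Yc * r2).
    by rewrite /cub r1E r2E mulrBr !(mulrCA p).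
  apply: (@dvd_translate_inv _ _ (Zc * r1 - Yc * r2)); first by rewrite -cubE.
  move=> u t; rewrite -cubE /cub !evE !meval_nfp /nf /dir !tri_inord /binquad.
  ring.
have := mdvd_translateB pE (mdvd_translateB pE (pnf (inord 0))).
suff -> : translate dir (translate dir (nfp (inord 0)) - nfp (inord 0)) -
    (translate dir (nfp (inord 0)) - nfp (inord 0)) = mpolyC 3 2.
  move=> [r rE]; exists (r * mpolyC 3 2^-1).
  by rewrite mulrA -rE -mpolyCM divff ?pnatr_eq0.
apply: mpoly_fun_inj => u; rewrite !(mevalB, meval_translate) mevalC.
rewrite !meval_nfp /nf /dir !tri_inord /binquad; ring.
Qed.

Lemma cubic0_coefs : cub = 0 ->
  [/\ W (inord 2) (inord 0) = 0, W (inord 2) (inord 1) = W (inord 1) (inord 0),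
      W (inord 2) (inord 2) = W (inord 1) (inord 1) & W (inord 1) (inord 2) = 0].
Proof.
move=> cub0.
have [d0 ae bf c0 _] : [/\ - W (inord 2) (inord 0) = 0,
    W (inord 1) (inord 0) - W (inord 2) (inord 1) = 0,
    W (inord 1) (inord 1) - W (inord 2) (inord 2) = 0, W (inord 1) (inord 2) = 0 & 0 = 0 :> K].
  apply: quartic_fun_eq0 => t.
  apply: etrans (etrans (congr1 (meval (tri 0 1 t)) cub0) (meval0 _)).
  rewrite /cub !evE !meval_nfp /nf !tri_inord /binquad; ring.
split=> //; first by apply/eqP; rewrite -oppr_eq0 d0.
- by apply/esym/eqP; rewrite -subr_eq0 ae.
- by apply/esym/eqP; rewrite -subr_eq0 bf.
Qed.

(** In sheared coordinates the normal form is (x + a y + b z) (x - a y - b z, y, z), a linear form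
    times an invertible linear map. *)
Lemma reduced_linear : cub = 0 -> exists g, is_reduced_map f g /\ birational g.
Proof.
move=> /cubic0_coefs [d0 e0 f0 c0].
have [hP hQ hR] := traceless_detE tW.
rewrite d0 e0 f0 c0 in hP hQ hR.
pose a := W (inord 1) (inord 0); pose b := W (inord 1) (inord 1).
rewrite -/a -/b in e0 f0 hP hQ hR.
pose D : mpoly 3 K := X 0 + a *: Yc + b *: Zc.
pose l x y z := tri (x - a * y - b * z) y z.
have nf_l x y z k : nf W x y z k = (x + a * y + b * z) * l x y z k.
  move: k; apply: ord3P;
  rewrite /nf /l !tri_inord ?d0 ?e0 ?f0 ?c0 -/a -/b /binquad ?hP ?hQ ?hR; ring.
pose L : 'M[K]_3 := \matrix_(k, j) tri (tri (1 + a * al + b * be) (- a) (- b) j)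
  (tri (- al) 1 0 j) (tri (- be) 0 1 j) k.
have L_l u k : \sum_j L k j * u j =
    l (u (inord 0)) (u (inord 1) - al * u (inord 0)) (u (inord 2) - be * u (inord 0)) k.
  rewrite sum3 !mxE; move: k; apply: ord3P; rewrite /l !tri_inord; ring.
have UL : L \in unitmx.
  apply: unitmx_ker0 => w Lw.
  have {}Lw k : \sum_j L k j * w j 0 = 0.
    by have /matrixP/(_ k 0) := Lw; rewrite [LHS]mxE [RHS]mxE.
  have := (Lw (inord 0), Lw (inord 1), Lw (inord 2)).
  rewrite !(L_l (w^~ 0)) /l !tri_inord => -[[E0 E1] E2].
  move: E0; rewrite E1 E2 !mulr0 !subr0 => E0.
  rewrite E0 !mulr0 !subr0 in E1 E2.
  by apply/colP; apply: ord3P; rewrite mxE.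
have DE u : meval u D = u (inord 0) + a * (u (inord 1) - al * u (inord 0))
    + b * (u (inord 2) - be * u (inord 0)) by rewrite /D !evE.
pose g := lin_tuple (S *m L).
have fE i : tnth f i = D * tnth g i.
  apply: mpoly_fun_inj => u; rewrite mevalM DE (meval_quad_nf U) meval_lin_tuple.
  pose w : 'cV_3 := \col_j u j.
  have -> : \sum_j (S *m L) i j * u j = (S *m (L *m w)) i 0.
    by rewrite mulmxA mxE; apply: eq_bigr => j _; congr (_ * _); rewrite mxE.
  rewrite [in RHS]mxE mulr_sumr; apply: eq_bigr => j _; rewrite nf_l mulrCA.
  congr (_ * (_ * _)); rewrite -L_l mxE.
  by apply: eq_bigr => k _; congr (_ * _); rewrite mxE.
exists g; split; last by apply: lin_tuple_birational; rewrite unitmx_mul U UL.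
exists D; split=> //; split=> [i|p pf]; first by exists (tnth g i).
have pnf i : mdvd p (nfp i) by apply: mdvd_sum.
have nfpE k : nfp k = D * tnth (lin_tuple L) k.
  by apply: mpoly_fun_inj => u; rewrite meval_nfp mevalM DE meval_lin_tuple L_l nf_l.
(* In sheared coordinates this is (-a, 1, 0), which fixes both [D] and z. A common divisor divides
   [D] z, so it is invariant along [dir], and it therefore divides the difference of [D] y, which is
   [D]. *)
pose dir := tri (- a) (1 - al * a) (- (be * a)).
have pE : translate dir p = p.
  have [r rE] := pnf (inord 2).
  apply: (@dvd_translate_inv _ _ r); rewrite -rE.
    apply: contra_neq (oner_neq0 K) => nf0.
    (* The point with sheared coordinates (1 - b, 0, 1), where [D] and z are both 1. *)
    have := congr1 (meval (tri (1 - b) (al * (1 - b)) (1 + be * (1 - b)))) nf0.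
    rewrite meval0 meval_nfp nf_l /l !tri_inord => <-; ring.
  move=> u t; rewrite !meval_nfp !nf_l /l /dir !tri_inord; ring.
have := mdvd_translateB pE (pnf (inord 1)).
suff -> : translate dir (nfp (inord 1)) - nfp (inord 1) = D by [].
apply: mpoly_fun_inj => u; rewrite mevalB meval_translate !meval_nfp DE.
rewrite !nf_l /l /dir !tri_inord; ring.
Qed.

Lemma traceless_det_reduced : exists g, is_reduced_map f g /\ birational g.
Proof.
have [/reduced_linear//|cub0] := eqVneq cub 0.
exists f; split; last exact: quad_triple_birational tW.
by exists 1; split=> [|i]; [exact: gcd1_of_cubic | rewrite mul1r].
Qed.

End Reduced.

(** * Local equations *)

Section Differentiability.
Variables (K : numFieldType) (V : normedModType K) (z : V).

Lemma differentiable_big_sum (I : Type) (s : seq I) (P : pred I) (F : I -> V -> K) :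
  (forall i, differentiable (F i) z) ->
  differentiable (fun y => \sum_(i <- s | P i) F i y) z.
Proof.
move=> dF; elim: s => [|i s IHs].
  rewrite (_ : (fun _ => _) = cst 0); first exact: differentiable_cst.
  by apply/funext => y; rewrite big_nil.
under eq_fun do rewrite big_cons.
by case: (P i) => //; apply: (differentiableD (dF i) IHs).
Qed.

Lemma differentiable_big_prod (I : Type) (s : seq I) (P : pred I) (F : I -> V -> K) :
  (forall i, differentiable (F i) z) ->
  differentiable (fun y => \prod_(i <- s | P i) F i y) z.
Proof.
move=> dF; elim: s => [|i s IHs].
  rewrite (_ : (fun _ => _) = cst 1); first exact: differentiable_cst.
  by apply/funext => y; rewrite big_nil.
under eq_fun do rewrite big_cons.
by case: (P i) => //; apply: (differentiableM (dF i) IHs).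
Qed.

Definition mx_differentiable m n (A : V -> 'M[K]_(m, n)) :=
  forall i j, differentiable (fun y => A y i j : K) z.

Lemma differentiable_det n (A : V -> 'M[K]_n) :
  mx_differentiable A -> differentiable (fun y => \det (A y) : K) z.
Proof.
move=> dA; apply: differentiable_big_sum => s.
apply: differentiableM; first exact: differentiable_cst.
by apply: differentiable_big_prod => i; exact: dA.
Qed.

Lemma mx_differentiable_adj n (A : V -> 'M[K]_n) :
  mx_differentiable A -> mx_differentiable (fun y => \adj (A y)).
Proof.
move=> dA i j; under eq_fun do rewrite mxE /cofactor.
apply: differentiableM; first exact: differentiable_cst.
apply: differentiable_det => k l; under eq_fun do rewrite !mxE.
exact: dA.
Qed.

Lemma mx_differentiable_mul m n p (A : V -> 'M[K]_(m, n)) (B : V -> 'M[K]_(n, p)) :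
  mx_differentiable A -> mx_differentiable B ->
  mx_differentiable (fun y => A y *m B y).
Proof.
move=> dA dB i j; under eq_fun do rewrite mxE.
apply: differentiable_big_sum => k; apply: differentiableM; [exact: dA | exact: dB].
Qed.

Lemma mx_differentiable_invmul n p (A : V -> 'M[K]_n) (B : V -> 'M[K]_(n, p)) :
  mx_differentiable A -> mx_differentiable B -> \det (A z) != 0 ->
  mx_differentiable (fun y => (\det (A y))^-1 *: (\adj (A y) *m B y)).
Proof.
move=> dA dB Az i j; under eq_fun do rewrite mxE.
apply: differentiableM.
  by apply: (differentiableV (differentiable_det dA)).
by apply: mx_differentiable_mul => //; exact: mx_differentiable_adj.
Qed.

Lemma differentiable_row n (F : V -> 'rV[K]_n.+1) :
  mx_differentiable F -> differentiable F z.
Proof.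
move=> dF; have -> : F = \sum_(i < n.+1) (fun y => F y 0 i *: delta_mx 0 i).
  by apply/funext => y; rewrite fct_sumE -row_sum_delta.
by apply: differentiable_sum => i; apply: differentiableZl; exact: dF.
Qed.

End Differentiability.

(* A line of an affine chart is a line of the cone over it with the parameter
   t / (1 - t k), once F is invariant under scaling. *)
Lemma derive_moebius (K : numFieldType) (V W : normedModType K) (F : V -> W)
    (z w : V) (k : K) (r : W) :
  (forall t, 1 - t * k != 0 -> F (z + t *: w) = F z + (t / (1 - t * k)) *: r) ->
  'D_w F z = r.
Proof.
move=> FE; rewrite /derive.
have k_cvg : (1 - t * k) @[t --> (0 : K)^'] --> (1 : K).
  have : {for 0, continuous (fun t : K => 1 - t * k)}.
    apply: continuousB; first exact: cst_continuous.
    by apply: continuousM; [exact: cvg_id | exact: cst_continuous].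
  rewrite /prop_for /continuous_at/= mul0r subr0; apply: cvg_trans.
  by apply: cvg_app; exact: nbhs_dnbhs.
apply: cvg_lim; first exact: norm_hausdorff.
have inv_cvg : (1 - t * k)^-1 *: r @[t --> (0 : K)^'] --> r.
  have rE : (1 : K)^-1 *: r = r by rewrite invr1 scale1r.
  rewrite -[X in _ --> X]rE.
  exact: cvgZr_tmp (cvgV (oner_neq0 K) k_cvg).
apply: cvg_trans inv_cvg; apply: near_eq_cvg.
have : \forall t \near (0 : K)^', 1 - t * k != 0.
  have /cvgrPdist_lt /(_ _ ltr01) := k_cvg.
  apply: filterS => t; apply: contraTneq => ->.
  by rewrite subr0 normr1 ltxx.
have t0 : \forall t \near (0 : K)^', t != 0 by exact: nbhs_dnbhs_neq.
apply: filterS2 t0 => t t0 tk /=.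
by rewrite [t *: w + z]addrC FE// [F z + _]addrC addrK scalerA mulrA mulVf// mul1r.
Qed.

Section LocalEquations.
Variables (K : numClosedFieldType) (al be : K).
Implicit Types (V : 'M[K]_(3, 6)) (W : 'M[K]_3) (v : 'rV[K]_18).

(** Cramer's rule for S^-1 times the tail, a form that is visibly differentiable where det S is
    nonzero. *)
Definition nf_mx V : 'M[K]_3 :=
  (\det (shear_mx al be V))^-1 *: (\adj (shear_mx al be V) *m tail_mx V).

Lemma nf_mxE V : shear_mx al be V \in unitmx ->
  nf_mx V = invmx (shear_mx al be V) *m tail_mx V.
Proof. by move=> U; rewrite /invmx U -scalemxAl. Qed.

Definition traceless_eqs W : 'rV[K]_3 :=
  let w i j := W (inord i) (inord j) in
  \row_k tri (w 0%N 0%N + w 1%N 0%N ^+ 2 + w 2%N 0%N * (w 1%N 1%N + w 2%N 2%N))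
    (w 0%N 1%N - 2 * w 1%N 0%N * w 2%N 2%N
     + (w 1%N 1%N + w 2%N 2%N) * (w 2%N 1%N + w 1%N 0%N) + w 1%N 2%N * w 2%N 0%N)
    (w 0%N 2%N + w 2%N 2%N ^+ 2 + w 1%N 2%N * (w 2%N 1%N + w 1%N 0%N)) k.

Lemma traceless_eqsE W k :
  let w i j := W (inord i) (inord j) in
  traceless_eqs W 0 k = tri (w 0%N 0%N + w 1%N 0%N ^+ 2 + w 2%N 0%N * (w 1%N 1%N + w 2%N 2%N))
    (w 0%N 1%N - 2 * w 1%N 0%N * w 2%N 2%N
     + (w 1%N 1%N + w 2%N 2%N) * (w 2%N 1%N + w 1%N 0%N) + w 1%N 2%N * w 2%N 0%N)
    (w 0%N 2%N + w 2%N 2%N ^+ 2 + w 1%N 2%N * (w 2%N 1%N + w 1%N 0%N)) k.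
Proof. exact: mxE. Qed.

Lemma traceless_eqsP W : traceless_det_mx W <-> traceless_eqs W = 0.
Proof.
split=> [[E0 E1 E2]|/rowP E].
  by apply/rowP; apply: ord3P; rewrite !mxE !tri_inord.
have := (E (inord 0), E (inord 1), E (inord 2)).
by rewrite !mxE !tri_inord => -[[E0 E1] E2]; split.
Qed.

Lemma mx_lincombE m n (A B : 'M[K]_(m, n)) k l i j :
  (k *: A + l *: B) i j = k * A i j + l * B i j.
Proof. by rewrite !mxE. Qed.

Lemma shear_mxD V V' k l :
  shear_mx al be (k *: V + l *: V') = k *: shear_mx al be V + l *: shear_mx al be V'.
Proof.
apply/matrixP => i j; rewrite mx_lincombE !shear_mxE.
by move: j; apply: ord3P; rewrite !tri_inord /quad_form /binquad !mx_lincombE; ring.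
Qed.

Lemma tail_mxD V V' k l :
  tail_mx (k *: V + l *: V') = k *: tail_mx V + l *: tail_mx V'.
Proof. by apply/matrixP => i j; rewrite !mxE. Qed.

Lemma vec_quadD v v' k l :
  vec_quad (k *: v + l *: v') = k *: vec_quad v + l *: vec_quad v'.
Proof. by rewrite /vec_quad linearD !linearZ. Qed.

(** Membership in [Bir2] may be witnessed by another representative of the line; rescaling
    multiplies S and the tail by the same scalar and leaves S^-1 times the tail unchanged. *)
Lemma Bir2_traceless v (p : Rat2 K) : v != 0 -> val p = <[v]>%VS ->
  shear_mx al be (vec_quad v) \in unitmx ->
  Bir2 p <-> traceless_det_mx (nf_mx (vec_quad v)).
Proof.
move=> v0 pE U; rewrite nf_mxE//; split=> [[v' [pE' [g [fg gB]]]]|tW].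
  have /vlineP[k v'E] : v' \in <[v]>%VS by rewrite -pE pE' memv_line.
  have k0 : k != 0.
    apply: contraNneq v0 => k0.
    have : v \in <[v']>%VS by rewrite -pE' pE memv_line.
    by rewrite v'E k0 scale0r => /vlineP[l ->]; rewrite scaler0.
  have v'0 : v' != 0 by rewrite v'E scaler_eq0 negb_or k0.
  have [m [G invG]] := birational_left_inverse v'0 fg gB.
  have VE : vec_quad v' = k *: vec_quad v + 0 *: vec_quad v.
    by rewrite -vec_quadD scale0r addr0 v'E.
  have SE : shear_mx al be (vec_quad v') = k *: shear_mx al be (vec_quad v).
    by rewrite VE shear_mxD scale0r addr0.
  have U' : shear_mx al be (vec_quad v') \in unitmx.
    by rewrite SE unitmxZ// unitfE.
  have := left_inverse_traceless invG U'.
  rewrite SE invmxZ -?SE// VE tail_mxD scale0r addr0.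
  by rewrite -scalemxAl -scalemxAr scalerA mulVf// scale1r.
by exists v; split=> //; exact: traceless_det_reduced tW.
Qed.

(** The equations contain the coefficients of p1 linearly, with coefficient 1. Moving p1 alone, with
    S and p fixed, therefore reaches every value [r]. *)
Lemma nf_mx_direction V (r : 'rV[K]_3) : shear_mx al be V \in unitmx ->
  exists V', forall k t, k != 0 ->
    (shear_mx al be (k *: V + t *: V') \in unitmx) /\
    traceless_eqs (nf_mx (k *: V + t *: V')) = traceless_eqs (nf_mx V) + (t / k) *: r.
Proof.
move=> U; set S := shear_mx al be V in U.
pose x i k := S i (inord 0) * r 0 (inord k).
(* The quadratic form with coefficients [r], taken at (y - al x, z - be x) and multiplied by the
   first column of S. It vanishes to second order at e, so its shear matrix is zero. *)
pose V' : 'M[K]_(3, 6) := \matrix_(i, j) nth 0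
  [:: al ^+ 2 * x i 0%N + al * be * x i 1%N + be ^+ 2 * x i 2%N;
      - (2 * al * x i 0%N + be * x i 1%N); - (al * x i 1%N + 2 * be * x i 2%N);
      x i 0%N; x i 1%N; x i 2%N] j.
have V'E i j : (j < 6)%N -> V' i (inord j) = nth 0
  [:: al ^+ 2 * x i 0%N + al * be * x i 1%N + be ^+ 2 * x i 2%N;
      - (2 * al * x i 0%N + be * x i 1%N); - (al * x i 1%N + 2 * be * x i 2%N);
      x i 0%N; x i 1%N; x i 2%N] j by move=> j6; rewrite mxE inordK.
have S'0 : shear_mx al be V' = 0.
  apply/matrixP => i j; rewrite shear_mxE [RHS]mxE; move: j.
  by apply: ord3P; rewrite !tri_inord /quad_form /binquad !V'E//=; ring.
pose E : 'M[K]_3 := \matrix_(i, j) (if i == inord 0 then r 0 j else 0).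
have EE j : (E (inord 0) j = r 0 j) * (E (inord 1) j = 0) * (E (inord 2) j = 0).
  by rewrite !mxE -!val_eqE/= !inordK.
have T'E : tail_mx V' = S *m E.
  apply/matrixP => i j; rewrite [LHS]mxE [RHS]mxE sum3 !EE !mulr0 !addr0; move: j.
  by apply: ord3P; rewrite inordK// ?V'E.
exists V' => k t k0.
have SE : shear_mx al be (k *: V + t *: V') = k *: S.
  by rewrite shear_mxD S'0 scaler0 addr0.
have U' : shear_mx al be (k *: V + t *: V') \in unitmx by rewrite SE unitmxZ// unitfE.
split=> //.
have -> : nf_mx (k *: V + t *: V') = nf_mx V + (t / k) *: E.
  rewrite !nf_mxE// SE invmxZ -?SE// tail_mxD T'E -/S.
  rewrite -scalemxAl mulmxDr -!scalemxAr mulKmx// scalerDr !scalerA mulVf// scale1r.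
  by rewrite [t / k]mulrC.
have WE j : ((nf_mx V + (t / k) *: E) (inord 0) j = nf_mx V (inord 0) j + t / k * r 0 j)
    * ((nf_mx V + (t / k) *: E) (inord 1) j = nf_mx V (inord 1) j)
    * ((nf_mx V + (t / k) *: E) (inord 2) j = nf_mx V (inord 2) j).
  have h a : (nf_mx V + (t / k) *: E) a j = nf_mx V a j + t / k * E a j.
    transitivity ((1 *: nf_mx V + (t / k) *: E) a j); first by rewrite scale1r.
    by rewrite mx_lincombE mul1r.
  by rewrite !h !EE !mulr0 !addr0.
move: (nf_mx V) WE => W WE.
apply/rowP => j; rewrite -[traceless_eqs W]scale1r mx_lincombE mul1r !traceless_eqsE/=.
by rewrite !WE; elim/ord3P: j; rewrite !tri_inord; ring.
Qed.

Variable i : 'I_18.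
Local Notation hom y := (vec_quad (affine_vec i y)).

Lemma affine_vec_neq0 (y : 'rV[K]_17) : affine_vec i y != 0.
Proof.
apply/eqP => /rowP /(_ i); rewrite !mxE unlift_none /=.
by apply/eqP; exact: oner_neq0.
Qed.

Let loc_eqs (y : 'rV[K]_17) : 'rV[K]_3 := traceless_eqs (nf_mx (hom y)).

Lemma derive_loc_eqs (z : 'rV[K]_17) (r : 'rV[K]_3) :
  shear_mx al be (hom z) \in unitmx -> exists w, 'D_w loc_eqs z = r.
Proof.
move=> U; have [V' V'E] := nf_mx_direction r U.
pose u : 'rV[K]_18 := mxvec V'; pose k := u 0 i.
(* Chosen so that the affine vector of z + t w is (1 - t k) times that of z plus t [u]; its
   coordinate [i] stays equal to 1. *)
exists (\row_j (u 0 (lift i j) - k * z 0 j)).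
apply: (@derive_moebius _ _ _ _ _ _ k) => t tk.
rewrite /loc_eqs -(V'E _ t tk).2; congr (traceless_eqs (nf_mx _)).
have uE : vec_quad u = V' by exact: mxvecK.
rewrite -[in RHS]uE -vec_quadD; congr vec_quad; apply/rowP => j.
rewrite mx_lincombE [LHS]mxE [affine_vec i z 0 j]mxE.
case: (unliftP i j) => [l|] ->.
  by rewrite /= !mxE; ring.
by rewrite /= -/k; ring.
Qed.

Lemma difD (z : 'rV[K]_17) (f g : 'rV[K]_17 -> K) :
  differentiable f z -> differentiable g z -> differentiable (fun y => f y + g y) z.
Proof. exact: differentiableD. Qed.

Lemma difM (z : 'rV[K]_17) (f g : 'rV[K]_17 -> K) :
  differentiable f z -> differentiable g z -> differentiable (fun y => f y * g y) z.
Proof. exact: differentiableM. Qed.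

Lemma difN (z : 'rV[K]_17) (f : 'rV[K]_17 -> K) :
  differentiable f z -> differentiable (fun y => - f y) z.
Proof. exact: differentiableN. Qed.

Lemma difC (z : 'rV[K]_17) (a : K) : differentiable (fun _ : 'rV[K]_17 => a) z.
Proof. exact: differentiable_cst. Qed.

Lemma dif_hom (z : 'rV[K]_17) : mx_differentiable z (fun y => hom y).
Proof.
move=> k j; under eq_fun do rewrite mxE mxE.
case: (unlift i _) => [l|] /=; [exact: differentiable_coord | exact: difC].
Qed.

Ltac solve_dif := repeat (first [exact: difC | exact: dif_hom | apply: difD
  | apply: difM | apply: difN]).

Lemma dif_shear (z : 'rV[K]_17) : mx_differentiable z (fun y => shear_mx al be (hom y)).
Proof.
move=> k; apply: ord3P; under eq_fun do rewrite shear_mxE !tri_inord /quad_form /binquad;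
solve_dif.
Qed.

Lemma dif_tail (z : 'rV[K]_17) : mx_differentiable z (fun y => tail_mx (hom y)).
Proof. by move=> k j; under eq_fun do rewrite mxE; exact: dif_hom. Qed.

Lemma differentiable_loc_eqs (z : 'rV[K]_17) :
  \det (shear_mx al be (hom z)) != 0 -> differentiable loc_eqs z.
Proof.
move=> U; have dW := mx_differentiable_invmul (@dif_shear z) (@dif_tail z) U.
apply: differentiable_row => k j; rewrite ord1 /loc_eqs.
by move: j; apply: ord3P; under eq_fun do rewrite mxE !tri_inord ?expr2 -/(nf_mx _);
  repeat (first [exact: difC | exact: dW | apply: difD | apply: difM | apply: difN]).
Qed.

Lemma open_shear_unit : open [set y | \det (shear_mx al be (hom y)) != 0].
Proof.
rewrite (_ : [set _ | _] = (fun y => \det (shear_mx al be (hom y))) @^-1` (~` [set 0])).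
  apply: open_comp; last first.
    by rewrite openC; apply: accessible_closed_set1; apply/hausdorff_accessible/norm_hausdorff.
  move=> y _; apply: (@differentiable_continuous _ _ K).
  exact: (differentiable_det (@dif_shear y)).
by apply/seteqP; split=> y /eqP.
Qed.

Lemma rank_jacobian_loc_eqs (z : 'rV[K]_17) :
  \det (shear_mx al be (hom z)) != 0 -> \rank ('J loc_eqs z) = 3%N.
Proof.
(* Every basis vector of the target is a directional derivative, so it lies in the row space of the
   Jacobian matrix. *)
move=> Uz; apply/eqP; rewrite -[_ == _]/(row_full _) -sub1mx; apply/row_subP => j.
have U : shear_mx al be (hom z) \in unitmx by rewrite unitmxE unitfE.
have [w <-] := derive_loc_eqs (row j 1%:M) U.
by rewrite deriveEjacobian ?submxMl//; exact: differentiable_loc_eqs.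
Qed.

End LocalEquations.

Lemma Bir2_submanifold (K : numClosedFieldType) : proj_submanifold (@Bir2 K).
Proof.
move=> i y0 /= y0B; have [v [vE [g [fg gB]]]] := y0B.
have v0 : v != 0.
  apply: contraNneq (affine_vec_neq0 i y0) => v0.
  have : affine_vec i y0 \in <[v]>%VS by rewrite -vE /= memv_line.
  by rewrite v0 => /vlineP[l ->]; rewrite scaler0.
have [m [G invG]] := birational_left_inverse v0 fg gB.
have [al [be Sv]] := shear_unit_exists invG.
exists [set y | \det (shear_mx al be (vec_quad (affine_vec i y))) != 0], 3%N,
  (fun y => traceless_eqs (nf_mx al be (vec_quad (affine_vec i y)))).
split.
- exact: open_shear_unit.
(* The vector [v] is a multiple of the affine representative of the point, and the shear matrix is
   linear in its argument. *)
- have /vlineP[k v'E] : v \in <[affine_vec i y0]>%VS by have := memv_line v; rewrite -vE.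
  have := Sv; rewrite unitmxE unitfE /=; apply: contraNneq => d0.
  have -> : vec_quad v = k *: vec_quad (affine_vec i y0) + 0 *: vec_quad (affine_vec i y0).
    by rewrite -vec_quadD scale0r addr0 v'E.
  by rewrite shear_mxD scale0r addr0 detZ d0 mulr0.
- exact: differentiable_loc_eqs.
- exact: rank_jacobian_loc_eqs.
- move=> z Uz; rewrite -traceless_eqsP.
  apply: Bir2_traceless => //; first exact: affine_vec_neq0.
  by rewrite unitmxE unitfE.
Qed.

Theorem mainTheorem4 (R : realType) :
  proj_submanifold (@Bir2 (complex R : numFieldType)).
Proof. exact: (@Bir2_submanifold (complex R)). Qed.
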